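(* Fix $\kappa>0$ and an integer $r\ge 1$. For $\epsilon>0$ let $Z$ denote the solution of the backward Loewner differential equation $$dZ_t=\frac{-2/\kappa}{Z_t}\,dt+dB_t,\qquad Z_0=\epsilon i,$$ where $B$ is a standard real Brownian motion, and let $\mathcal{E}^{r}_{(V)}(Z_0,\mathbf{X}_{0,t})$ be its one-step $r$-truncated Taylor approximation on $[0,t]$. Then there is a finite constant $C$, depending only on $r$ (for the fixed $\kappa$), such that for all sufficiently small $\epsilon>0$, $$\left\|\,Z_{t}-\mathcal{E}^{r}_{(V)}(Z_0,\mathbf{X}_{0,t})\,\right\|_{L^2(\mathbb{P})}\le C\,\epsilon\qquad\text{for all } t\in\big[0,\epsilon^{2}\big].$$
   Context: $\mathbb{H}=\{z\in\mathbb{C}:\operatorname{Im} z>0\}$. The solution $Z$ takes values in $\mathbb{H}$, and its imaginary part is increasing in time. For a complex random variable $Y$, $\|Y\|_{L^2(\mathbb{P})}=\mathbb{E}[|Y|^2]^{1/2}$. Vector fields: regarded as first-order differential operators acting on holomorphic functions $f$ on $\mathbb{H}$, put $$(V_0 f)(z)=\frac{-2/\kappa}{z}\,f'(z),\qquad (V_1 f)(z)=\frac{\partial f}{\partial x}(z)=f'(z)\qquad (z=x+iy),$$ and let $\mathbf{Id}(z)=z$. For a multi-index $I=(i_1,\dots,i_k)\in\{0,1\}^k$, $V_{i_1}\cdots V_{i_k}\mathbf{Id}$ denotes the function obtained by composing the operators, $V_{i_1}(V_{i_2}(\cdots(V_{i_k}\mathbf{Id})))$; for the empty multi-index it is $\mathbf{Id}$.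 Iterated integrals: let $X_t=(X^0_t,X^1_t)=(t,B_t)$ be space-time Brownian motion, and $$\mathbf{X}_{0,t}^{i_1,\dots,i_k}=\int_{0<s_1<\cdots<s_k<t}dX^{i_1}_{s_1}\cdots dX^{i_k}_{s_k},$$ where the integrals are all taken in the Itô sense or all taken in the Stratonovich sense (either enhancement of $X$ to a rough path may be used); for the empty multi-index the value is $1$. Taylor approximation: $$\mathcal{E}^{r}_{(V)}(Z_0,\mathbf{X}_{0,t})=\sum_{I=(i_1,\dots,i_k):\,\deg(I)\le r}V_{i_1}\cdots V_{i_k}\mathbf{Id}(Z_0)\,\mathbf{X}_{0,t}^{i_1,\dots,i_k},$$ where $\deg(I)=k$ is the length of $I$ and the empty multi-index (contributing $Z_0$) is included. *)

(* Defs.v *)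
Set Warnings "-notation-overridden,-notation-incompatible-prefix".
From mathcomp Require Import all_boot all_order all_algebra.
From mathcomp Require Import complex.
From mathcomp Require Import all_classical all_reals all_analysis.

Set Implicit Arguments.
Unset Strict Implicit.
Unset Printing Implicit Defensive.

Import Order.TTheory GRing.Theory Num.Theory.
Import numFieldNormedType.Exports.

Local Open Scope classical_set_scope.
Local Open Scope ring_scope.
Local Open Scope complex_scope.

(** * Brownian motion

    A process indexed by time is a function on [R]; only its values at times
    [t >= 0] are ever constrained or used. *)

Section brownian_motion.
Context d (T : measurableType d) (R : realType) (P : probability T R).
Implicit Types B : R -> {RV P >-> R}.

Definition natural_filtration B (t : R) : set (set T) :=
  <<s [set A | exists s (D : set R),
         [/\ 0 <= s <= t, measurable D & A = B s @^-1` D]] >>.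

Definition increment B (s t : R) (w : T) : R := B t w - B s w.

(** The second parameter of [normal_prob] is the standard deviation. *)
Definition brownian_motion B : Prop :=
  [/\ {ae P, forall w, B 0 w = 0},
      (forall (s t : R) (A : set T) (D : set R), 0 <= s <= t ->
         natural_filtration B s A -> measurable D ->
         P (A `&` increment B s t @^-1` D) =
         (P A * P (increment B s t @^-1` D))%E),
      (forall (s t : R) (D : set R), 0 <= s < t -> measurable D ->
         P (increment B s t @^-1` D) = normal_prob 0 (Num.sqrt (t - s)) D) &
      {ae P, forall w, {within `[0, +oo[, continuous (fun t => B t w)}}].

End brownian_motion.

(** * Stochastic integrals over [0, t]

    A partition 0 = p_0 < p_1 < ... < p_n = t is represented, as in
    [itv_partition 0 t p], by the sequence [p] of its points other than 0. *)

Section stochastic_integrals.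
Context d (T : measurableType d) (R : realType) (P : probability T R).
Implicit Types (B Y : R -> {RV P >-> R}) (J : {RV P >-> R}).
Implicit Types (p : seq R) (xi : nat -> T -> R).

Definition point p (k : nat) : R := (0 :: p)`_k.

(** The integrand sum_k xi_k 1_{]p_k, p_{k+1}]}, with each xi_k bounded and
    known at time p_k. *)
Definition simple_integrand B (t : R) p xi : Prop :=
  itv_partition 0 t p /\
  forall k, (k < size p)%N ->
    (exists M : R, forall w, `|xi k w| <= M) /\
    (forall D : set R, measurable D ->
       natural_filtration B (point p k) (xi k @^-1` D)).

Definition simple_value p xi (s : R) (w : T) : R :=
  \sum_(k < size p) xi k w * (point p k < s <= point p k.+1)%R%:R.

Definition simple_integral B p xi (w : T) : R :=
  \sum_(k < size p) xi k w * increment B (point p k) (point p k.+1) w.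

(** The Ito integral as the extension by the Ito isometry: [J] is the
    L^2(P)-limit of integrals of simple integrands converging to [Y] in
    L^2([0, t] x Omega, ds x P). *)
Definition ito_integral B Y (t : R) J : Prop :=
  exists (p : nat -> seq R) (xi : nat -> nat -> T -> R),
    [/\ (forall n, simple_integrand B t (p n) (xi n)),
        (\int[lebesgue_measure]_(s in `[0%R, t])
           'E_P[fun w => ((simple_value (p n) (xi n) s w - Y s w) ^+ 2)%R])%E
          @[n --> \oo] --> 0%E &
        ('E_P[fun w => ((simple_integral B (p n) (xi n) w - J w) ^+ 2)%R])%E
          @[n --> \oo] --> 0%E].

(** Limit in probability, as the mesh tends to 0, of the sums of products of
    increments of [Y] and [B]. *)
Definition quadratic_covariation B Y (t : R) J : Prop :=
  forall e h : R, 0 < e -> 0 < h ->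
    exists2 mesh : R, 0 < mesh &
      forall p, itv_partition 0 t p ->
        (forall k, (k < size p)%N -> point p k.+1 - point p k < mesh) ->
        (P [set w | (e <= `|\sum_(k < size p)
               increment Y (point p k) (point p k.+1) w *
               increment B (point p k) (point p k.+1) w - J w|)%R] <= h%:E)%E.

Definition stratonovich_integral B Y (t : R) J : Prop :=
  exists I Q : {RV P >-> R},
    [/\ ito_integral B Y t I, quadratic_covariation B Y t Q &
        {ae P, forall w, J w = I w + Q w / 2}].

Inductive integral_sense := Ito | Stratonovich.

Definition stochastic_integral (sense : integral_sense) :=
  match sense with
  | Ito => ito_integral
  | Stratonovich => stratonovich_integral
  end.

(** [X (i_1, ..., i_k) t] is the iterated integral over
    0 < s_1 < ... < s_k < t, the outermost variable being s_k.  Index 0 is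
    time and index 1 is [B]. *)
Definition iterated_integrals (sense : integral_sense) B
    (X : seq 'I_2 -> R -> {RV P >-> R}) : Prop :=
  [/\ (forall t w, 0 <= t -> X [::] t w = 1),
      (forall I, {ae P, forall w,
         {within `[0, +oo[, continuous (fun t => X I t w)}}),
      (forall I t, 0 <= t -> {ae P, forall w,
         X (rcons I 0) t w =
         \int[lebesgue_measure]_(s in `[0, t]) X I s w}) &
      (forall I t, 0 <= t ->
         stochastic_integral sense B (X I) t (X (rcons I 1) t))].

End stochastic_integrals.

(** * Backward Loewner equation *)

Definition complex_integral (R : realType) (D : set R) (f : R -> R[i]) : R[i] :=
  (\int[lebesgue_measure]_(s in D) complex.Re (f s)) +i*
  (\int[lebesgue_measure]_(s in D) complex.Im (f s)).

Definition backward_loewner d (T : measurableType d) (R : realType)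
    (P : probability T R) (kappa : R) (B : R -> {RV P >-> R}) (z0 : R[i])
    (Z : R -> T -> R[i]) : Prop :=
  (forall t, 0 <= t -> measurable_fun setT (fun w => complex.Re (Z t w)) /\
                       measurable_fun setT (fun w => complex.Im (Z t w))) /\
  {ae P, forall w,
    [/\ {within `[0, +oo[, continuous (fun t => Z t w : R[i]^o)},
        (forall t, 0 <= t -> 0 < complex.Im (Z t w)),
        Z 0 w = z0 &
        (forall t, 0 <= t ->
           Z t w = z0 +
             complex_integral `[0, t] (fun s => (- 2 / kappa)%:C / Z s w) +
             (B t w)%:C)]}.

(** * Taylor approximation *)

Section taylor.
Context (R : realType).
Implicit Types (f : R[i] -> R[i]) (z : R[i]).

(** [R[i]^o] is [R[i]] as a normed space over itself, so that [derive1] is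
    the complex derivative. *)
Definition complex_derive f : R[i] -> R[i] := derive1 (f : R[i]^o -> R[i]^o).

Definition V (kappa : R) (i : 'I_2) f : R[i] -> R[i] :=
  fun z => if i == 0 then (- 2 / kappa)%:C / z * complex_derive f z
           else complex_derive f z.

(** V_{i_1} (V_{i_2} (... (V_{i_k} Id))) *)
Definition V_Id (kappa : R) (I : seq 'I_2) : R[i] -> R[i] :=
  foldr (V kappa) id I.

Definition taylor (kappa : R) (r : nat) z (x : seq 'I_2 -> R) : R[i] :=
  \sum_(k < r.+1) \sum_(I : k.-tuple 'I_2) V_Id kappa I z * (x I)%:C.

End taylor.

Definition L2norm d (T : measurableType d) (R : realType)
    (P : probability T R) (Y : T -> R[i]) : \bar R :=
  ('N[P]_2%:E[(fun w => (ComplexField.Normc.normc (Y w))%:E)])%E.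

(* Main.v *)
Require Import Defs.
Set Warnings "-notation-overridden,-notation-incompatible-prefix,-ambiguous-paths".
From HB Require Import structures.
From mathcomp Require Import all_boot all_order all_algebra.
From mathcomp Require Import complex.
From mathcomp Require Import all_classical all_reals all_analysis.
From mathcomp Require Import measurable_realfun.
From mathcomp Require Import ring lra.

Import Order.TTheory GRing.Theory Num.Theory.
Import numFieldNormedType.Exports.

Local Open Scope ring_scope.
Local Open Scope complex_scope.
Local Open Scope classical_set_scope.

Set Implicit Arguments.
Unset Strict Implicit.
Unset Printing Implicit Defensive.

(** The estimate holds term by term. On [0, eps^2] each of Z_t - Z_0 and the
    terms of positive degree of the Taylor polynomial has L^2 norm of order eps,
    and the term of degree zero is Z_0 itself, so that the triangle inequality
    suffices.

    For Z_t - Z_0, the imaginary part of Z is nondecreasing, so |Z_s| >= eps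
    and the drift is at most (2/kappa)/eps; integrated over a time at most eps^2
    it contributes O(eps) ([loewner_drift]), and so does B_t, whose variance is
    of order t.

    For the Taylor terms, let w be the weight of the multi-index I, where an
    index 0 (time) counts twice and an index 1 (Brownian motion) once. The
    iterated vector field is c z^(1-w) ([V_Id_power]), of modulus |c| eps^(1-w)
    at z = i eps, while the iterated integral over [0, t] with t <= h has second
    moment at most 73^|I| h^w ([msq_iterated_integral]). With h = eps^2 the
    powers of eps cancel up to one factor eps.

    The moment bound goes by induction on I, adding the outermost integrator
    last, and carries along the bound E (X_v - X_u)^2 <= C (v - u) h^(w-1) on
    the increments, without which the Stratonovich correction cannot be
    controlled. Against dt it is Cauchy-Schwarz and Tonelli, for which a process
    with continuous paths is replaced by a jointly measurable one
    ([continuous_process_joint_measurable], [msq_time_integral]). Against dB in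
    the Ito sense it is the inequality part of the Ito isometry for simple
    integrands; to compare the integrals over [0, t] and [0, s], two simple
    integrands are rewritten over a common partition
    ([msq_simple_integralB], [msq_ito_increment]). In the Stratonovich sense one
    adds half of the covariation of X and B, approximated over [s, t] by sums R
    with R^2 <= (sum of (dX)^2) (sum of (dB)^2). The first factor has expectation
    of order t - s by induction. The second is at most 9 (t - s) outside of an
    event whose probability vanishes with the mesh, since the compensated squares
    (dB)^2 - E (dB)^2 are orthogonal and fourth moments are of order (dt)^2
    ([quadratic_variation_tail], [msq_covariation_increment]).

    Everything stochastic thus rests on the orthogonality of martingale
    differences ([msq_sum_increments]), deduced from the independence of an
    increment from the past through the product of the two laws, and on the
    first, second and fourth moments of Gaussian increments. *)

(** * Gaussian moments *)

Section density.
Context d (T : measurableType d) (R : realType).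
Variables (mu nu : {measure set T -> \bar R}) (p : T -> R).
Hypothesis mp : measurable_fun setT p.
Let mp' : measurable_fun setT (EFin \o p).
Proof. exact/measurable_EFinP. Qed.
Hypothesis p0 : forall x, 0 <= p x.
Let p0' x : (0 <= (p x)%:E)%E. Proof. by rewrite lee_fin. Qed.
Hypothesis nuE : forall A, measurable A -> nu A = (\int[mu]_(x in A) (p x)%:E)%E.
Import HBNNSimple.

(** Both sides agree on simple functions by additivity, and in general by monotone
    convergence. *)
Lemma ge0_integral_density (f : T -> \bar R) :
  measurable_fun setT f -> (forall x, 0 <= f x)%E ->
  (\int[nu]_x f x = \int[mu]_x (f x * (p x)%:E))%E.
Proof.
move=> mf f0.
have simple (g : {nnsfun T >-> R}) : (\int[nu]_x (g x)%:E =
    \int[mu]_x ((g x)%:E * (p x)%:E))%E.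
  under eq_integral do rewrite fimfunE -fsumEFin//.
  rewrite ge0_integral_fsum//; last 2 first.
  - by move=> r; exact/measurable_EFinP/measurableT_comp.
  - by move=> n x _; rewrite EFinM nnfun_muleindic_ge0.
  under [RHS]eq_integral.
    move=> x _; rewrite fimfunE -fsumEFin// ge0_mule_fsuml; last first.
      by move=> r; rewrite EFinM nnfun_muleindic_ge0.
    over.
  rewrite ge0_integral_fsum//; last 2 first.
  - by move=> r; apply: emeasurable_funM => //; apply/measurable_EFinP; exact: measurable_funM.
  - by move=> n x _; rewrite mule_ge0// EFinM nnfun_muleindic_ge0.
  apply: eq_fsbigr => r; rewrite inE => -[x _ <-].
  under eq_integral do rewrite EFinM.
  rewrite ge0_integralZl//; last 2 first.
  - by apply/measurable_EFinP; exact: measurable_indic.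
  - by rewrite lee_fin.
  under [RHS]eq_integral do rewrite EFinM -muleA.
  rewrite ge0_integralZl//; last 3 first.
  - by apply: emeasurable_funM => //; apply/measurable_EFinP; exact: measurable_indic.
  - by move=> y _; rewrite mule_ge0// lee_fin.
  - by rewrite lee_fin.
  rewrite integral_indic// setIT /= nuE// (integral_mkcond (g @^-1` _)).
  congr (_ * _)%E; apply: eq_integral => y _.
  by rewrite /= patchE indicE; case: ifPn => _; rewrite ?mul1e ?mul0e.
pose g := nnsfun_approx measurableT mf.
have cg x : EFin \o g^~ x @ \oo --> f x by exact: cvg_nnsfun_approx.
have ndg x m n : (m <= n)%N -> ((g m x)%:E <= (g n x)%:E)%E.
  by move=> mn; rewrite lee_fin; exact/lefP/nd_nnsfun_approx.
have h1 : (\int[nu]_x (g n x)%:E)%E @[n --> \oo] -->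
    (\int[nu]_x f x)%E.
  rewrite [X in _ --> X](_ : _ =
      \int[nu]_x limn (fun n => (g n x)%:E))%E; last first.
    by apply: eq_integral => x _; apply/esym/cvg_lim => //; exact: cg.
  apply: cvg_monotone_convergence => //.
  - by move=> n; exact/measurable_EFinP.
  - by move=> n x _; rewrite lee_fin.
  - by move=> x _ m n; exact: ndg.
have h2 : (\int[mu]_x ((g n x)%:E * (p x)%:E))%E @[n --> \oo] -->
    (\int[mu]_x (f x * (p x)%:E))%E.
  rewrite [X in _ --> X](_ : _ =
      \int[mu]_x limn (fun n => (g n x)%:E * (p x)%:E))%E; last first.
    apply: eq_integral => x _; apply/esym/cvg_lim => //.
    under eq_fun do rewrite muleC.
    rewrite muleC; apply: cvgeZl => //; exact: (cg x).
  apply: (@cvg_monotone_convergence _ T R mu setT measurableT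
    (fun n x => (g n x)%:E * (p x)%:E)%E) => //.
  - by move=> n; apply: emeasurable_funM => //; exact/measurable_EFinP.
  - by move=> n x _; rewrite mule_ge0// lee_fin.
  - by move=> x _ m n mn; rewrite lee_wpmul2r//; exact: ndg.
have h2' : (\int[nu]_x (g n x)%:E)%E @[n --> \oo] -->
    (\int[mu]_x (f x * (p x)%:E))%E.
  by under eq_fun do rewrite simple.
exact: (cvg_unique _ h1 h2').
Qed.

End density.

Section gaussian.
Context (R : realType).
Local Notation mu := (@lebesgue_measure R).

Lemma ge0_integral_normal_prob (s : R) (f : R -> \bar R) :
  measurable_fun setT f -> (forall x, 0 <= f x)%E ->
  (\int[normal_prob 0 s]_x f x = \int[mu]_x (f x * (normal_pdf 0 s x)%:E))%E.
Proof.
move=> mf f0; apply: ge0_integral_density => //.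
- exact: measurable_normal_pdf.
- exact: normal_pdf_ge0.
Qed.

(** Half of the Gaussian exponent is given up; what is left is the density of the
    normal law with standard deviation multiplied by sqrt 2. Moments are thereby
    bounded by the total mass of another normal law. *)
Lemma normal_pdf_spread (s x : R) : 0 < s ->
  expR (x ^+ 2 / (4 * s ^+ 2)) * normal_pdf 0 s x =
  Num.sqrt 2 * normal_pdf 0 (Num.sqrt 2 * s) x.
Proof.
move=> s0; have s20 : 0 < Num.sqrt 2 * s by rewrite mulr_gt0// sqrtr_gt0.
rewrite !normal_pdfE ?gt_eqF// /normal_peak /normal_fun subr0 exprMn sqr_sqrtr//.
rewrite mulrCA -expRD [RHS]mulrA; congr (_ * _); last first.
  congr expR; have := lt0r_neq0 s0 => ?.
  by field.
rewrite -[2 * _ * _]mulrA -[in RHS]mulrnAr [in RHS]sqrtrM// invfM mulrA divff ?mul1r//.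
Qed.

(** The factor 2 bounds the sqrt 2 of [normal_pdf_spread]. *)
Lemma normal_moment (s c : R) (f : R -> R) : 0 < s -> 0 <= c ->
  measurable_fun setT f ->
  (forall x, 0 <= f x <= c * expR (x ^+ 2 / (4 * s ^+ 2))) ->
  (\int[normal_prob 0 s]_x (f x)%:E <= (2 * c)%:E)%E.
Proof.
move=> s0 c0 mf fc.
rewrite ge0_integral_normal_prob//; last 2 first.
- exact/measurable_EFinP.
- by move=> x; rewrite lee_fin; case/andP: (fc x).
apply: (@le_trans _ _ (\int[mu]_x ((c * Num.sqrt 2)%:E *
    (normal_pdf 0 (Num.sqrt 2 * s) x)%:E))%E).
  apply: ge0_le_integral => //.
  - move=> x _; rewrite mule_ge0// lee_fin; last exact: normal_pdf_ge0.
    by case/andP: (fc x).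
  - apply: emeasurable_funM; apply/measurable_EFinP => //.
    exact: measurable_normal_pdf.
  - apply: emeasurable_funM => //; apply/measurable_EFinP => //.
    exact: measurable_normal_pdf.
  - move=> x _; rewrite -!EFinM lee_fin -mulrA -normal_pdf_spread// mulrA.
    rewrite ler_wpM2r//; first exact: normal_pdf_ge0.
    by case/andP: (fc x).
rewrite ge0_integralZl//; last 3 first.
- by apply/measurable_EFinP; exact: measurable_normal_pdf.
- by move=> x _; rewrite lee_fin normal_pdf_ge0.
- by rewrite lee_fin mulr_ge0.
rewrite integral_normal_pdf mule1 lee_fin mulrC ler_wpM2r//.
rewrite -(@ler_pXn2r _ 2)// ?nnegrE// sqr_sqrtr//; lra.
Qed.

Lemma normal_moment2 (s : R) : 0 < s ->
  (\int[normal_prob 0 s]_x (x ^+ 2)%:E <= (8 * s ^+ 2)%:E)%E.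
Proof.
move=> s0; rewrite (_ : 8 * _ = 2 * (4 * s ^+ 2)); last by ring.
apply: normal_moment => //; first by rewrite mulr_ge0// ?sqr_ge0.
move=> x; rewrite sqr_ge0/= mulrC -ler_pdivrMr ?mulr_gt0// ?exprn_gt0//.
by apply: le_trans (expR_ge1Dx _); rewrite lerDr.
Qed.

Lemma normal_moment4 (s : R) : 0 < s ->
  (\int[normal_prob 0 s]_x (x ^+ 4)%:E <= (128 * s ^+ 4)%:E)%E.
Proof.
move=> s0; rewrite (_ : 128 * _ = 2 * (64 * s ^+ 4)); last by ring.
apply: normal_moment => //; first by rewrite mulr_ge0// exprn_even_ge0.
move=> x; rewrite exprn_even_ge0//= mulrC -ler_pdivrMr ?mulr_gt0// ?exprn_gt0//.
set y := x ^+ 2 / (4 * s ^+ 2).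
have y0 : 0 <= y by apply: divr_ge0; [exact: sqr_ge0|apply: mulr_ge0 => //; exact: sqr_ge0].
have -> : x ^+ 4 / (64 * s ^+ 4) = (y / 2) ^+ 2.
  by rewrite /y; have := lt0r_neq0 s0 => ?; field.
have -> : y = y / 2 + y / 2 by lra.
rewrite expRD expr2 (_ : (y/2+y/2)/2 = y/2); last by lra.
(* Squaring y / 2 <= exp (y / 2) bounds y^2 by 4 exp y. *)
have h : y / 2 <= expR (y / 2) by apply: le_trans (expR_ge1Dx _); rewrite lerDr.
by apply: ler_pM => //; rewrite divr_ge0.
Qed.

Lemma integral_reflect (f : R -> \bar R) :
  measurable_fun setT f -> (forall x, 0 <= f x)%E ->
  (\int[mu]_x f x = \int[mu]_x f (- x)%R)%E.
Proof.
move=> mf f0.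
have mN : measurable_fun setT (-%R : measurableTypeR R -> measurableTypeR R).
  exact: oppr_measurable.
have := @ge0_integral_pushforward _ _ _ _ R _ mN mu setT f measurableT mf.
rewrite preimage_setT => <-//.
by apply: eq_measure_integral => //= A mA _; exact/esym/lebesgue_measureN.
Qed.

(** The density is even, so the positive and negative parts have equal integrals;
    these are finite since |x| <= s exp (x^2 / (4 s^2)). *)
Lemma normal_mean0 (s : R) : 0 < s ->
  (\int[normal_prob 0 s]_x x%:E = 0)%E.
Proof.
move=> s0.
have mpos : measurable_fun setT (fun x : R => Num.max x 0)
  by exact: measurable_maxr.
have mneg : measurable_fun setT (fun x : R => Num.max (- x) 0).
  by apply: measurable_maxr => //; exact: oppr_measurable.
rewrite integralE.
have posE : (EFin : R -> \bar R)^\+%E = fun x => (Num.max x 0)%:E.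
  by apply/funext => x; rewrite funeposE EFin_max.
have negE : (EFin : R -> \bar R)^\-%E = fun x => (Num.max (- x) 0)%:E.
  by apply/funext => x; rewrite funenegE EFin_max.
have posneg : (\int[normal_prob 0 s]_x (Num.max x 0)%:E =
    \int[normal_prob 0 s]_x (Num.max (- x) 0)%:E)%E.
  rewrite !ge0_integral_normal_prob//; last 4 first.
  - exact/measurable_EFinP.
  - by move=> x; rewrite lee_fin le_max lexx orbT.
  - exact/measurable_EFinP.
  - by move=> x; rewrite lee_fin le_max lexx orbT.
  rewrite integral_reflect; last 2 first.
  - apply: emeasurable_funM; apply/measurable_EFinP => //.
    exact: measurable_normal_pdf.
  - move=> x; rewrite mule_ge0// lee_fin; last exact: normal_pdf_ge0.
    by rewrite le_max lexx orbT.
  apply: eq_integral => x _.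
  by rewrite !normal_pdfE ?gt_eqF// /normal_fun !subr0 sqrrN.
rewrite posE negE posneg subee// ge0_fin_numE; last first.
  by apply: integral_ge0 => x _; rewrite lee_fin le_max lexx orbT.
apply: (@le_lt_trans _ _ (2 * s)%:E); last exact: ltry.
apply: normal_moment => //; first exact: ltW.
move=> x; rewrite le_max lexx orbT/=.
apply: (@le_trans _ _ (s * (1 + x ^+ 2 / (4 * s ^+ 2)))); last first.
  rewrite ler_wpM2l //; [exact: ltW|exact: expR_ge1Dx].
have -> : s * (1 + x ^+ 2 / (4 * s ^+ 2)) = s + x ^+ 2 / (4 * s).
  by have := lt0r_neq0 s0 => ?; field.
rewrite ge_max; apply/andP; split; last first.
  by rewrite addr_ge0 ?(ltW s0)// divr_ge0 ?sqr_ge0// mulr_ge0// ltW.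
have -> : s + x ^+ 2 / (4 * s) = - x + (x + 2 * s) ^+ 2 / (4 * s).
  by have := lt0r_neq0 s0 => ?; field.
by rewrite lerDl divr_ge0 ?sqr_ge0// mulr_ge0// ltW.
Qed.

End gaussian.

(** * Integrals of independent random variables *)

Section independence.
Context d (T : measurableType d) (R : realType) (P : probability T R).
Variables X Y : {RV P >-> R}.
Hypothesis indep : forall A D : set R, measurable A -> measurable D ->
  P (X @^-1` A `&` Y @^-1` D) = (P (X @^-1` A) * P (Y @^-1` D))%E.

Let pair w := (X w, Y w).

Let mpair : measurable_fun setT pair.
Proof. exact: measurable_fun_pair. Qed.

Let XY := (distribution P X \x distribution P Y)%E.

Let joint_law A : measurable A -> XY A = pushforward P pair A.
Proof.
pose mp := isMeasurableFun.Build _ _ _ _ pair mpair.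
pose p : {mfun T >-> (R * R)%type} := HB.pack pair mp.
move=> mA; apply: (@product_measure_unique _ _ _ _ _ _ _ (distribution P p)) => //.
Qed.

Lemma independent_integral (f : R * R -> \bar R) :
  measurable_fun setT f -> (forall z, 0 <= f z)%E ->
  (\int[P]_w f (X w, Y w) =
   \int[distribution P X]_x \int[distribution P Y]_y f (x, y))%E.
Proof.
move=> mf f0.
have /= := @fubini_tonelli1 _ _ _ _ _ (distribution P X) (distribution P Y) f mf f0.
rewrite /fubini_F => <-.
have /= <- := @ge0_integral_pushforward _ _ _ _ R pair mpair P setT f measurableT mf.
- by apply: eq_measure_integral => A mA _; exact/esym/joint_law.
- by move=> z _.
Qed.


Lemma independent_ge0M (f g : R -> \bar R) :
  measurable_fun setT f -> measurable_fun setT g ->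
  (forall x, 0 <= f x)%E -> (forall x, 0 <= g x)%E ->
  (\int[P]_w (f (X w) * g (Y w)) =
   (\int[P]_w f (X w)) * (\int[P]_w g (Y w)))%E.
Proof.
move=> mf mg f0 g0.
have mfg : measurable_fun setT (fun z : R * R => f z.1 * g z.2)%E.
  by apply: emeasurable_funM; exact: measurableT_comp.
have /= -> := independent_integral mfg; last by move=> z; exact: mule_ge0.
under eq_integral do rewrite ge0_integralZl//.
rewrite ge0_integralZr//; last exact: integral_ge0.
by rewrite !ge0_integral_distribution.
Qed.

(** Integrability is Tonelli for the absolute values; then Fubini integrates [Y]
    out first. *)
Lemma independent_mean0 :
  P.-integrable setT (EFin \o X) -> P.-integrable setT (EFin \o Y) ->
  (\int[P]_w (Y w)%:E = 0)%E ->
  P.-integrable setT (fun w => (X w * Y w)%:E) /\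
  (\int[P]_w (X w * Y w)%:E = 0)%E.
Proof.
move=> iX iY Y0.
pose f (z : R * R) := (z.1 * z.2)%:E.
have mf : measurable_fun setT f.
  by apply/measurable_EFinP; apply: measurable_funM.
have mabs : measurable_fun setT (fun x : R => `|x%:E|%E).
  by apply: measurableT_comp => //; exact/measurable_EFinP.
have iXY : P.-integrable setT (fun w => (X w * Y w)%:E).
  apply/integrableP; split; first exact/measurable_EFinP/measurable_funM.
  under eq_integral do rewrite EFinM abseM.
  rewrite (independent_ge0M mabs mabs)//.
  move: iX iY => /integrableP[_ iX] /integrableP[_ iY].
  have iX0 : (0 <= \int[P]_w `|(X w)%:E|)%E by exact: integral_ge0.
  by apply: lte_mul_pinfty => //; rewrite ge0_fin_numE.
split => //.
have iXYl : (distribution P X \x distribution P Y)%E.-integrable setT f.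
  apply/integrable12ltyP => //.
  have /= <- := @independent_integral (abse \o f).
  - by case/integrableP : iXY.
  - exact: measurableT_comp.
  - by [].
have /= := @integral_pushforward _ _ _ _ R pair mpair P setT f mf iXY measurableT.
rewrite preimage_setT => <-.
transitivity (\int[(distribution P X \x distribution P Y)%E]_z f z)%E.
  by apply: eq_measure_integral => A mA _; exact/esym/joint_law.
rewrite -integral12_prod_meas1//.
apply: integral0_eq => x _; rewrite /fubini_F /f /=.
under eq_integral do rewrite EFinM.
rewrite integralZl//=; last first.
  apply: integrable_pushforward => //.
rewrite integral_distribution//.
  by rewrite Y0 mule0.
Qed.

End independence.

(** * Second moments *)

Section mean_square.
Context d (T : measurableType d) (R : realType) (P : probability T R).
Implicit Types U V : T -> R.

Definition msq U : \bar R := (\int[P]_w (U w ^+ 2)%:E)%E.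

Definition square_integrable U := measurable_fun setT U /\ (msq U < +oo)%E.

Lemma msq_ge0 U : (0 <= msq U)%E.
Proof. by apply: integral_ge0 => w _; rewrite lee_fin sqr_ge0. Qed.

Lemma measurable_sqr_EFin U : measurable_fun setT U ->
  measurable_fun setT (fun w => (U w ^+ 2)%:E).
Proof. by move=> mU; apply/measurable_EFinP; exact: measurable_funX. Qed.

Lemma ae_le_msq U V : measurable_fun setT U -> measurable_fun setT V ->
  {ae P, forall w, U w ^+ 2 <= V w ^+ 2} -> (msq U <= msq V)%E.
Proof.
move=> mU mV UV; apply: ae_ge0_le_integral => //.
- by move=> w _; rewrite lee_fin sqr_ge0.
- exact: measurable_sqr_EFin.
- by move=> w _; rewrite lee_fin sqr_ge0.
- exact: measurable_sqr_EFin.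
- by apply: filterS UV => w UVw _; rewrite lee_fin.
Qed.

Lemma ae_eq_msq U V : measurable_fun setT U -> measurable_fun setT V ->
  {ae P, forall w, U w = V w} -> msq U = msq V.
Proof.
move=> mU mV UV; apply/eqP; rewrite eq_le; apply/andP; split;
by apply: ae_le_msq => //; apply: filterS UV => w ->.
Qed.

Lemma msqZ c U : measurable_fun setT U ->
  msq (fun w => c * U w) = ((c ^+ 2)%:E * msq U)%E.
Proof.
move=> mU; rewrite /msq -ge0_integralZl//.
- by apply: eq_integral => w _; rewrite exprMn EFinM.
- exact: measurable_sqr_EFin.
- by move=> w _; rewrite lee_fin sqr_ge0.
- by rewrite lee_fin sqr_ge0.
Qed.

Lemma msq_cst c : msq (cst c) = (c ^+ 2)%:E.
Proof.
rewrite /msq -[LHS]/(\int[P]_w (cst (c ^+ 2)%:E) w)%E.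
by rewrite integral_cst// [X in (_ * X)%E]probability_setT mule1.
Qed.

(** Convexity of the square. By induction, the cross term being split as
    2 u s <= n u^2 + s^2 / n. *)
Lemma sqr_sum_le (I : Type) (r : seq I) (u : I -> R) :
  (\sum_(i <- r) u i) ^+ 2 <= (size r)%:R * \sum_(i <- r) u i ^+ 2.
Proof.
elim: r => [|i r ih]; first by rewrite !big_nil expr0n mul0r.
rewrite !big_cons /=; set s := \sum_(j <- r) u j in ih *.
set q := \sum_(j <- r) u j ^+ 2 in ih *.
have q0 : 0 <= q by apply: sumr_ge0 => j _; exact: sqr_ge0.
have [r0|r0] := posnP (size r).
  rewrite r0 mul0r in ih; have s0 : s = 0.
    by apply/eqP; rewrite -sqrf_eq0 eq_le ih sqr_ge0.
  by rewrite r0 s0 addr0 mul1r lerDl.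
set n : R := (size r)%:R in ih *.
have n0 : 0 < n by rewrite ltr0n.
have cross : 2 * (u i * s) <= n * u i ^+ 2 + s ^+ 2 / n.
  have -> : n * u i ^+ 2 + s ^+ 2 / n = 2 * (u i * s) + (n * u i - s) ^+ 2 / n.
    by have := lt0r_neq0 n0 => ?; field.
  by rewrite lerDl divr_ge0 ?sqr_ge0// ltW.
have sn : s ^+ 2 / n <= q by rewrite ler_pdivrMr// mulrC.
rewrite -natr1 -/n.
have -> : (u i + s) ^+ 2 = u i ^+ 2 + 2 * (u i * s) + s ^+ 2 by ring.
have -> : (n + 1) * (u i ^+ 2 + q) =
  u i ^+ 2 + (n * u i ^+ 2 + q) + n * q by ring.
by rewrite lerD// lerD2l (le_trans cross)// lerD2l.
Qed.

Lemma msq_sum_le (I : Type) (r : seq I) (U : I -> T -> R) :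
  (forall i, measurable_fun setT (U i)) ->
  (msq (fun w => \sum_(i <- r) U i w)%R <=
   (size r)%:R%:E * \sum_(i <- r) msq (U i))%E.
Proof.
move=> mU; rewrite /msq -ge0_integral_sum//; last 2 first.
- by move=> i; exact: measurable_sqr_EFin.
- by move=> i w _; rewrite lee_fin sqr_ge0.
rewrite -ge0_integralZl//; last 2 first.
- by apply: emeasurable_sum => i; exact: measurable_sqr_EFin.
- by move=> w _; apply: sume_ge0 => i _; rewrite lee_fin sqr_ge0.
apply: ge0_le_integral => //.
- by move=> w _; rewrite lee_fin sqr_ge0.
- by apply: measurable_sqr_EFin; exact: measurable_sum.
- apply: measurable_funeM; apply: emeasurable_sum => i.
  exact: measurable_sqr_EFin.
- move=> w _; rewrite sumEFin -EFinM lee_fin; exact: sqr_sum_le.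
Qed.

Lemma msqD_le U V : measurable_fun setT U -> measurable_fun setT V ->
  (msq (fun w => U w + V w)%R <= 2%:E * (msq U + msq V))%E.
Proof.
move=> mU mV.
have := @msq_sum_le bool [:: true; false] (fun b => if b then U else V).
rewrite /= !big_cons big_nil adde0.
under eq_fun do rewrite !big_cons big_nil addr0.
by apply; case.
Qed.

Lemma square_integrable_integrable U : square_integrable U ->
  P.-integrable setT (EFin \o U).
Proof.
move=> [mU U2].
have : P.-integrable setT (fun w => (1 + U w ^+ 2)%:E).
  have -> : (fun w => (1 + U w ^+ 2)%:E) =
      (EFin \o cst 1) \+ (fun w => (U w ^+ 2)%:E) by apply/funext.
  apply: integrableD => //; first exact: finite_measure_integrable_cst.
  apply/integrableP; split; first exact: measurable_sqr_EFin.
  by under eq_integral do rewrite gee0_abs ?lee_fin ?sqr_ge0//.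
apply: le_integrable => //; first exact/measurable_EFinP.
move=> w _; rewrite /= lee_fin [leRHS]ger0_norm ?addr_ge0 ?sqr_ge0//.
rewrite -(real_normK (num_real (U w))).
by have := normr_ge0 (U w); set n := `|U w|; nra.
Qed.

Lemma square_integrableM U V : square_integrable U -> square_integrable V ->
  P.-integrable setT (fun w => (U w * V w)%:E).
Proof.
move=> [mU U2] [mV V2].
have isq W : measurable_fun setT W -> (msq W < +oo)%E ->
    P.-integrable setT (fun w => (W w ^+ 2)%:E).
  move=> mW W2; apply/integrableP; split; first exact: measurable_sqr_EFin.
  by under eq_integral do rewrite gee0_abs ?lee_fin ?sqr_ge0//.
have := integrableD measurableT (isq _ mU U2) (isq _ mV V2).
apply: le_integrable => //; first exact/measurable_EFinP/measurable_funM.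
move=> w _; rewrite /= lee_fin [leRHS]ger0_norm ?addr_ge0 ?sqr_ge0//.
by rewrite ler_norml; apply/andP; split; nra.
Qed.

Lemma square_integrableD U V : square_integrable U -> square_integrable V ->
  square_integrable (fun w => U w + V w).
Proof.
move=> [mU U2] [mV V2]; split; first exact: measurable_funD.
apply: le_lt_trans (msqD_le mU mV) _.
by rewrite lte_mul_pinfty// lte_add_pinfty.
Qed.

Lemma msqD_orthogonal U V : square_integrable U -> square_integrable V ->
  (\int[P]_w (U w * V w)%:E = 0)%E ->
  msq (fun w => U w + V w) = (msq U + msq V)%E.
Proof.
move=> sU sV UV0; have iUV := square_integrableM sU sV.
case: sU sV => mU U2 [mV V2].
have isq W : measurable_fun setT W -> (msq W < +oo)%E ->
    P.-integrable setT (fun w => (W w ^+ 2)%:E).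
  move=> mW W2; apply/integrableP; split; first exact: measurable_sqr_EFin.
  by under eq_integral do rewrite gee0_abs ?lee_fin ?sqr_ge0//.
rewrite /msq.
transitivity (\int[P]_w (((U w ^+ 2)%:E + (V w ^+ 2)%:E) + 2%:E * (U w * V w)%:E))%E.
  by apply: eq_integral => w _; rewrite -EFinM -!EFinD; congr EFin; ring.
rewrite integralD//; last 2 first.
- by apply: integrableD => //; exact: isq.
- exact: integrableZl.
rewrite integralZl// UV0 mule0 adde0 integralD//; exact: isq.
Qed.

End mean_square.

(** * The Brownian past and orthogonality of increments *)

Section filtration.
Context d (T : measurableType d) (R : realType) (P : probability T R).
Variable B : R -> {RV P >-> R}.

(** This family generates [natural_filtration]; it is named so that the past can be
    put as a measurable structure on the sample space. *)
Definition past (t : R) : set (set T) :=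
  [set A | exists s (D : set R),
    [/\ 0 <= s <= t, measurable D & A = B s @^-1` D]].

(** Measurability for the past, stated on a copy of the sample space that carries it,
    so that the closure properties of measurable functions apply to adapted ones. *)
Definition adapted (t : R) (U : T -> R) :=
  measurable_fun setT (U : g_sigma_algebraType (past t) -> R).

Lemma adapted_measurable t U : adapted t U -> measurable_fun setT U.
Proof.
move=> aU mT D mD; rewrite setTI.
have := aU measurableT D mD; rewrite setTI.
move: (U @^-1` D); apply: smallest_sub; first exact: sigma_algebra_measurable.
move=> A [s [C [_ mC ->]]].
by rewrite -[X in measurable X]setTI; exact: measurable_funP.
Qed.

Lemma adapted_le s t U : s <= t -> adapted s U -> adapted t U.
Proof.
move=> st aU mT D mD; have := aU measurableT D mD.
apply: sub_sigma_algebra2 => A [u [C [/andP[u0 us] mC ->]]].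
by exists u, C; split => //; rewrite u0 (le_trans us).
Qed.

Lemma adapted_at s t : 0 <= s <= t -> adapted t (B s).
Proof.
move=> st mT D mD; rewrite setTI; apply: sub_sigma_algebra.
by exists s, D.
Qed.

Lemma adapted_increment s t u : 0 <= s -> s <= t -> t <= u ->
  adapted u (increment B s t).
Proof.
move=> s0 st tu; apply: measurable_funB; apply: adapted_at.
  by rewrite (le_trans s0)/=.
by rewrite s0/= (le_trans st).
Qed.

Lemma measurable_increment s t : measurable_fun setT (increment B s t).
Proof. by apply: measurable_funB. Qed.

Hypothesis bB : brownian_motion B.

Lemma increment_independent s t U (phi : R -> R) (A D : set R) :
  0 <= s <= t -> adapted s U -> measurable_fun setT phi ->
  measurable A -> measurable D ->
  P (U @^-1` A `&` (phi \o increment B s t) @^-1` D) =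
  (P (U @^-1` A) * P ((phi \o increment B s t) @^-1` D))%E.
Proof.
move=> st aU mphi mA mD; case: bB => _ indep _ _.
rewrite comp_preimage; apply: indep => //.
- by have := aU measurableT A mA; rewrite setTI.
- by rewrite -[X in measurable X]setTI; exact: mphi.
Qed.

(** An increment is independent of the past, so a centred function of it is
    orthogonal to everything known before. *)
Lemma adapted_increment_orthogonal s t U (phi : R -> R) :
  0 <= s <= t -> adapted s U -> measurable_fun setT phi ->
  P.-integrable setT (EFin \o U) ->
  P.-integrable setT (EFin \o (phi \o increment B s t)) ->
  (\int[P]_w (phi (increment B s t w))%:E = 0)%E ->
  (\int[P]_w (U w * phi (increment B s t w))%:E = 0)%E.
Proof.
move=> st aU mphi iU iV V0.
have mU := adapted_measurable aU.
have mV : measurable_fun setT (phi \o increment B s t).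
  by apply: measurableT_comp => //; exact: measurable_increment.
pose X : {RV P >-> R} := HB.pack U (isMeasurableFun.Build _ _ _ _ U mU).
pose Y : {RV P >-> R} := HB.pack (phi \o increment B s t)
  (isMeasurableFun.Build _ _ _ _ (phi \o increment B s t) mV).
have [] // := @independent_mean0 _ _ _ P X Y.
by move=> A D mA mD; exact: increment_independent.
Qed.

Lemma msq_adapted_increment s t U (phi : R -> R) :
  0 <= s <= t -> adapted s U -> measurable_fun setT phi ->
  msq P (fun w => U w * phi (increment B s t w)) =
  (msq P U * msq P (phi \o increment B s t))%E.
Proof.
move=> st aU mphi.
have mU := adapted_measurable aU.
have mV : measurable_fun setT (phi \o increment B s t).
  by apply: measurableT_comp => //; exact: measurable_increment.
pose X : {RV P >-> R} := HB.pack U (isMeasurableFun.Build _ _ _ _ U mU).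
pose Y : {RV P >-> R} := HB.pack (phi \o increment B s t)
  (isMeasurableFun.Build _ _ _ _ (phi \o increment B s t) mV).
have msq' : measurable_fun setT (fun x : R => (x ^+ 2)%:E).
  exact/measurable_EFinP.
have /= := @independent_ge0M _ _ _ P X Y _ (fun x => (x ^+ 2)%:E)
  (fun x => (x ^+ 2)%:E) msq' msq'.
rewrite /msq => <-.
- by apply: eq_integral => w _; rewrite exprMn EFinM.
- by move=> A D mA mD; exact: increment_independent.
- by move=> x; rewrite lee_fin sqr_ge0.
- by move=> x; rewrite lee_fin sqr_ge0.
Qed.

(** Pythagoras for martingale differences: the [n] summands are pairwise
    orthogonal since each has mean zero given the past. *)
Lemma msq_sum_increments (x : nat -> R) (n : nat) (U : nat -> T -> R)
    (phi : nat -> R -> R) :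
  (forall k, (k < n)%N -> 0 <= x k <= x k.+1) ->
  (forall k, (k < n)%N -> adapted (x k) (U k)) ->
  (forall k, (k < n)%N -> exists M : R, forall w, `|U k w| <= M) ->
  (forall k, measurable_fun setT (phi k)) ->
  (forall k, (k < n)%N ->
    (msq P (phi k \o increment B (x k) (x k.+1)) < +oo)%E) ->
  (forall k, (k < n)%N ->
    (\int[P]_w (phi k (increment B (x k) (x k.+1) w))%:E = 0)%E) ->
  msq P (fun w => \sum_(k < n) U k w * phi k (increment B (x k) (x k.+1) w)) =
  (\sum_(k < n) msq P (U k) * msq P (phi k \o increment B (x k) (x k.+1)))%E.
Proof.
move=> x_mono aU bU mphi V2 V0.
pose V k := phi k \o increment B (x k) (x k.+1).
have mV k : measurable_fun setT (V k).
  by apply: measurableT_comp => //; exact: measurable_increment.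
have sV k : (k < n)%N -> square_integrable P (V k).
  by move=> kn; split => //; exact: V2.
have sUV k : (k < n)%N -> square_integrable P (fun w => U k w * V k w).
  move=> kn; have mU := adapted_measurable (aU _ kn); split.
    exact: measurable_funM.
  have [M UM] := bU _ kn; have M0 w : 0 <= M := le_trans (normr_ge0 _) (UM w).
  apply: (@le_lt_trans _ _ (msq P (fun w => M * V k w))).
    apply: ae_le_msq; [exact: measurable_funM|exact: measurable_funM|].
    apply/nearW => w; rewrite !exprMn ler_wpM2r ?sqr_ge0//.
    by rewrite -(real_normK (num_real (U k w))) lerXn2r ?nnegrE// (M0 w).
  by rewrite msqZ// lte_mul_pinfty ?lee_fin ?sqr_ge0//; exact: V2.
pose S m w := \sum_(k < m) U k w * V k w.
have S_prop m : (m <= n)%N -> [/\ (forall k, (k < n)%N -> (m <= k)%N ->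
      adapted (x k) (S m)), square_integrable P (S m) &
    msq P (S m) = (\sum_(k < m) msq P (U k) * msq P (V k))%E].
  elim: m => [_|m ih mn].
    rewrite (_ : S 0%N = cst 0); last first.
      by apply/funext => w; rewrite /S big_ord0.
    split; first by move=> k _ _; exact: measurable_cst.
      by split; [exact: measurable_cst|rewrite msq_cst ltry].
    by rewrite msq_cst big_ord0 expr0n.
  have [aS sS S2] := ih (ltnW mn).
  have SE : S m.+1 = fun w => S m w + U m w * V m w.
    by apply/funext => w; rewrite /S big_ord_recr.
  have /andP[xm0 xm1] := x_mono _ mn.
  split.
  - move=> k kn mk; rewrite SE.
    have xk : x m.+1 <= x k.
      elim: k mk kn => // k ihk; rewrite leq_eqVlt => /predU1P[<-//|mk kn].
      by rewrite (le_trans (ihk mk (ltnW kn)))//; case/andP: (x_mono _ (ltnW kn)).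
    apply: measurable_funD.
      by apply: (adapted_le (le_trans xm1 xk)); exact: aS.
    apply: measurable_funM.
      by apply: (adapted_le (le_trans xm1 xk)); exact: aU.
    by apply: measurableT_comp => //; exact: adapted_increment.
  - by rewrite SE; apply: square_integrableD => //; exact: sUV.
  - rewrite SE msqD_orthogonal//; [|exact: sUV|].
      rewrite big_ord_recr/= S2; congr (_ + _)%E.
      by rewrite msq_adapted_increment// ?xm0//; exact: aU.
    under eq_integral do rewrite mulrA.
    apply: (@adapted_increment_orthogonal _ _ (fun w => S m w * U m w)) => //.
    + by rewrite xm0.
    + by apply: measurable_funM; [exact: aS|exact: aU].
    + apply: square_integrableM => //; split.
        exact: (adapted_measurable (aU _ mn)).
      have [M UM] := bU _ mn.
      apply: (@le_lt_trans _ _ (msq P (cst M))); last by rewrite msq_cst ltry.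
      apply: ae_le_msq => //; first exact: (adapted_measurable (aU _ mn)).
      apply/nearW => w; rewrite -(real_normK (num_real (U m w))).
      by rewrite lerXn2r ?nnegrE// (le_trans (normr_ge0 _) (UM w)).
    + by apply: square_integrable_integrable; exact: sV.
    + exact: V0.
by have [] := S_prop n (leqnn n).
Qed.

End filtration.

(** * Moments and quadratic variation of Brownian motion *)

Section brownian_moments.
Context d (T : measurableType d) (R : realType) (P : probability T R).
Variable B : R -> {RV P >-> R}.
Hypothesis bB : brownian_motion B.

Let increment_law s t : 0 <= s < t ->
  forall D, measurable D -> pushforward P (increment B s t : T -> R) D =
    normal_prob 0 (Num.sqrt (t - s)) D.
Proof. by move=> st D mD; case: bB => _ _ law _; rewrite -law. Qed.

Lemma ge0_integral_increment s t (f : R -> \bar R) : 0 <= s < t ->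
  measurable_fun setT f -> (forall x, 0 <= f x)%E ->
  (\int[P]_w f (increment B s t w) =
   \int[normal_prob 0 (Num.sqrt (t - s))]_x f x)%E.
Proof.
move=> st mf f0.
have mI : measurable_fun setT (increment B s t : T -> measurableTypeR R).
  exact: measurable_increment.
have /= := @ge0_integral_pushforward _ _ _ _ R _ mI P
  setT f measurableT mf.
rewrite preimage_setT => <-//.
by apply: eq_measure_integral => D mD _; exact: increment_law.
Qed.

Lemma msq_increment s t : 0 <= s -> s <= t ->
  (msq P (increment B s t) <= (8 * (t - s))%:E)%E.
Proof.
move=> s0; rewrite le_eqVlt => /predU1P[<-|st].
  rewrite subrr mulr0 /msq integral0_eq// => w _.
  by rewrite /increment subrr expr0n.
have ts0 : 0 < t - s by rewrite subr_gt0.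
rewrite /msq (@ge0_integral_increment _ _ (fun x => (x ^+ 2)%:E)) ?s0//.
- have := @normal_moment2 R (Num.sqrt (t - s)).
  by rewrite sqrtr_gt0 sqr_sqrtr ?(ltW ts0)//; exact.
- exact/measurable_EFinP.
- by move=> x; rewrite lee_fin sqr_ge0.
Qed.

Lemma msq_sqr_increment s t : 0 <= s < t ->
  (msq P (fun w => increment B s t w ^+ 2)%R <= (128 * (t - s) ^+ 2)%:E)%E.
Proof.
move=> /[dup] st /andP[_]; rewrite -subr_gt0 => ts0.
rewrite /msq.
under eq_integral do rewrite -exprM.
rewrite (@ge0_integral_increment _ _ (fun x => (x ^+ 4)%:E)) ?s0//.
- have := @normal_moment4 R (Num.sqrt (t - s)).
  by rewrite sqrtr_gt0 (exprM _ 2 2) sqr_sqrtr ?(ltW ts0)//; exact.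
- exact/measurable_EFinP.
- by move=> x; rewrite lee_fin exprn_even_ge0.
Qed.

Lemma square_integrable_increment s t : 0 <= s -> s <= t ->
  square_integrable P (increment B s t).
Proof.
move=> s0 st; split; first exact: measurable_increment.
exact: le_lt_trans (msq_increment s0 st) (ltry _).
Qed.

Lemma mean_increment s t : 0 <= s < t ->
  (\int[P]_w (increment B s t w)%:E = 0)%E.
Proof.
move=> /[dup] st /andP[s0 ts].
have mE : measurable_fun setT (EFin : R -> \bar R) by exact/measurable_EFinP.
have iI := square_integrable_integrable (square_integrable_increment s0 (ltW ts)).
have mI : measurable_fun setT (increment B s t : T -> measurableTypeR R).
  exact: measurable_increment.
have /= := @integral_pushforward _ _ _ _ R _ mI P
  setT _ mE iI measurableT.
rewrite preimage_setT => <-.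
rewrite -(@normal_mean0 R (Num.sqrt (t - s))) ?sqrtr_gt0 ?subr_gt0//.
by apply: eq_measure_integral => D mD _; exact: increment_law.
Qed.

(** The compensated squared increments are centred, hence orthogonal, so their sum
    has variance of the order of the mesh, and Chebyshev applies. The expected sum of
    squares is at most 8 L; the ninth L leaves room for the deviation. *)
Lemma quadratic_variation_tail (x : nat -> R) (n : nat) (m L : R) :
  (forall k, (k < n)%N -> 0 <= x k < x k.+1) ->
  (forall k, (k < n)%N -> x k.+1 - x k <= m) ->
  x n - x 0 = L -> 0 < L ->
  (P [set w | (9 * L <= \sum_(k < n) increment B (x k) (x k.+1) w ^+ 2)%R] <=
   (384 * m / L)%:E)%E.
Proof.
move=> x_mono x_mesh xL L0.
pose M k := fine (msq P (increment B (x k) (x k.+1))).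
have ME k : (k < n)%N -> msq P (increment B (x k) (x k.+1)) = (M k)%:E.
  move=> kn; have /andP[xk xk1] := x_mono _ kn.
  rewrite fineK// ge0_fin_numE ?msq_ge0//.
  by case: (square_integrable_increment xk (ltW xk1)).
have M8 k : (k < n)%N -> 0 <= M k <= 8 * (x k.+1 - x k).
  move=> kn; have /andP[xk xk1] := x_mono _ kn.
  rewrite -!lee_fin -ME// msq_ge0/=; exact: msq_increment (ltW xk1).
have sumD (j : nat) : \sum_(k < j) (x k.+1 - x k) = x j - x 0%N.
  elim: j => [|j ih]; first by rewrite big_ord0 subrr.
  by rewrite big_ord_recr/= ih; ring.
pose phi k (y : R) := y ^+ 2 - M k.
have mphi k : measurable_fun setT (phi k).
  by apply: measurable_funB => //; exact: measurable_cst.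
have V2 k : (k < n)%N -> (msq P (phi k \o increment B (x k) (x k.+1)) <=
    (384 * (x k.+1 - x k) ^+ 2)%:E)%E.
  move=> kn; have /andP[xk xk1] := x_mono _ kn; have /andP[M0 Mk8] := M8 _ kn.
  apply: (le_trans (msqD_le _ _ _)).
  - by apply: measurable_funX; exact: measurable_increment.
  - exact: measurable_cst.
  - rewrite msq_cst sqrrN.
    have := msq_sqr_increment (x_mono _ kn).
    have : (0 <= msq P (fun w => increment B (x k) (x k.+1) w ^+ 2)%R)%E.
      exact: msq_ge0.
    case: (msq _ _) => [q| |]//; rewrite -EFinD -EFinM !lee_fin => _ q128.
    have : M k ^+ 2 <= (8 * (x k.+1 - x k)) ^+ 2 by rewrite lerXn2r// nnegrE ?(le_trans M0).
    by rewrite exprMn; nra.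
have V0 k : (k < n)%N ->
    (\int[P]_w (phi k (increment B (x k) (x k.+1) w))%:E = 0)%E.
  move=> kn; have /andP[xk xk1] := x_mono _ kn.
  under eq_integral do rewrite /phi EFinB.
  rewrite integralB//; last 2 first.
  - by under eq_fun do rewrite expr2; apply: square_integrableM;
      exact: (square_integrable_increment _ (ltW xk1)).
  - exact: finite_measure_integrable_cst.
  have := ME _ kn; rewrite /msq => ->.
  rewrite -[X in (_ - X)%E]/(\int[P]_w (cst (M k)%:E) w)%E integral_cst//.
  by rewrite [X in (_ - _ * X)%E]probability_setT mule1 subee.
pose S w := \sum_(k < n) 1 * phi k (increment B (x k) (x k.+1) w).
have mS : measurable_fun setT S.
  apply: measurable_sum => k; apply: measurable_funM => //.
  by apply: (measurableT_comp (mphi k)); exact: measurable_increment.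
have S2 : (msq P S <= (384 * m * L)%:E)%E.
  rewrite /S (@msq_sum_increments _ _ _ _ _ bB x n (fun _ => cst 1))//.
  - apply: (@le_trans _ _ (\sum_(k < n) (384 * m * (x k.+1 - x k))%:E)%E).
      apply: lee_sum => k _; rewrite msq_cst expr1n mul1e.
      apply: (le_trans (V2 _ (ltn_ord k))); rewrite lee_fin expr2 -!mulrA.
      rewrite ler_wpM2l// ler_wpM2r ?x_mesh// subr_ge0 ltW//.
      by case/andP: (x_mono _ (ltn_ord k)).
    by rewrite sumEFin lee_fin -mulr_sumr sumD xL.
  - by move=> k /x_mono/andP[-> /ltW].
  - by move=> k _; exact: measurable_cst.
  - by move=> k _; exists 1 => w; rewrite normr1.
  - by move=> k kn; apply: le_lt_trans (V2 _ kn) (ltry _).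
set A := [set w | _].
have mA : measurable A.
  rewrite -[A]setTI; apply: measurable_fun_le => //.
  by apply: measurable_sum => k; apply: measurable_funX; exact: measurable_increment.
have AS w : A w -> L ^+ 2 <= S w ^+ 2.
  rewrite /A /= => Aw; suff LS : L <= S w by rewrite lerXn2r ?nnegrE ?(le_trans (ltW L0))// ltW.
  have -> : S w = \sum_(k < n) increment B (x k) (x k.+1) w ^+ 2 - \sum_(k < n) M k.
    by rewrite /S -sumrB; apply: eq_bigr => k _; rewrite mul1r.
  have : \sum_(k < n) M k <= 8 * L.
    rewrite -xL -sumD mulr_sumr; apply: ler_sum => k _.
    by case/andP: (M8 _ (ltn_ord k)).
  by move: Aw; lra.
have PA : ((L ^+ 2)%:E * P A <= msq P S)%E.
  rewrite -integral_cst// /msq.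
  apply: (@le_trans _ _ (\int[P]_(w in A) (S w ^+ 2)%:E)%E).
    apply: ge0_le_integral => //.
    - by move=> w _; rewrite lee_fin sqr_ge0.
    - by apply: measurable_funTS; exact: measurable_sqr_EFin.
  apply: ge0_subset_integral => //; first exact: measurable_sqr_EFin.
  by move=> w _; rewrite lee_fin sqr_ge0.
have L20 : 0 < L ^+ 2 by rewrite exprn_gt0.
rewrite (_ : 384 * m / L = (L ^+ 2)^-1 * (384 * m * L)); last first.
  by have := lt0r_neq0 L0 => ?; field.
by rewrite EFinM lee_pdivlMl//; exact: le_trans PA S2.
Qed.

End brownian_moments.

(** * Partitions of an interval *)

Section partitions.
Context (R : realType).
Implicit Types (a b c s t u : R) (p q : seq R).

(** With [a = 0] these are the points [point p]; the covariation over [s, t] needs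
    partitions that start at [s]. *)
Definition node a p (k : nat) : R := (a :: p)`_k.

Lemma node_last a b p : itv_partition a b p -> node a p (size p) = b.
Proof. by move=> [_ /eqP <-]; rewrite /node (last_nth 0). Qed.

Lemma node_lt a b p k : itv_partition a b p -> (k < size p)%N ->
  node a p k < node a p k.+1.
Proof. by move=> [/(pathP 0) + _] => /(_ k) h /h. Qed.

Lemma node_le a b p j k : itv_partition a b p -> (j <= k)%N -> (k <= size p)%N ->
  node a p j <= node a p k.
Proof.
move=> abp; elim: k => [|k ih]; first by rewrite leqn0 => /eqP ->.
rewrite leq_eqVlt => /predU1P[-> //|jk kp].
by rewrite (le_trans (ih jk (ltnW kp)))// ltW// (node_lt abp).
Qed.

Lemma node_ge0 t p k : itv_partition 0 t p -> (k <= size p)%N ->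
  0 <= node 0 p k.
Proof. by move=> tp kp; have := node_le tp (leq0n k) kp. Qed.

Lemma node_leb a b p k : itv_partition a b p -> (k <= size p)%N -> node a p k <= b.
Proof. by move=> tp kp; rewrite -(node_last tp) (node_le tp). Qed.

Lemma mem_node a p k : (k <= size p)%N -> node a p k \in a :: p.
Proof. by move=> kp; apply: mem_nth. Qed.

Lemma mem_nodeP a p c : c \in a :: p -> exists2 k, (k <= size p)%N & c = node a p k.
Proof.
move=> cp; exists (index c (a :: p)); last by rewrite /node nth_index.
by rewrite -ltnS -[(size p).+1]/(size (a :: p)) index_mem.
Qed.

Lemma node_gap a b p c k : itv_partition a b p -> (k < size p)%N ->
  c \in a :: p -> c < node a p k.+1 -> c <= node a p k.
Proof.
move=> abp kp /mem_nodeP[j jp ->]; have [jk _|kj] := leqP j k.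
  by apply: (node_le abp jk); exact: ltnW.
by rewrite ltNge (node_le abp kj).
Qed.

Lemma common_refinement s t p q : s <= t ->
  itv_partition 0 t p -> itv_partition 0 s q ->
  exists r, [/\ itv_partition 0 t r, {subset p <= r} & {subset q <= r}].
Proof.
move=> st tp sq; have s0 := itv_partition_le sq.
have [t0|t0] := eqVneq t 0.
  exists [::]; move: tp sq; rewrite t0 in st *.
  have -> : s = 0 by apply/le_anti; rewrite st.
  by move=> /itv_partitionxx -> /itv_partitionxx ->.
pose r := sort <=%R (undup (p ++ q)).
have memr x : (x \in r) = (x \in p) || (x \in q).
  by rewrite mem_sort mem_undup mem_cat.
have pos v y (l : seq R) : itv_partition 0 v l -> y \in l -> 0 < y <= v.
  move=> vl /(nthP 0)[i il <-]; rewrite -[l`_i]/(node 0 l i.+1).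
  rewrite (node_leb vl il) andbT.
  exact: le_lt_trans (node_ge0 vl (ltnW il)) (node_lt vl il).
have rpos x : x \in r -> 0 < x <= t.
  rewrite memr => /orP[/(pos _ _ _ tp)//|/(pos _ _ _ sq)/andP[-> xs]].
  exact: le_trans xs st.
have tr : t \in r.
  rewrite memr -(node_last tp); case: (p) tp => [/itv_partition_nil t00|y l _].
    by rewrite t00 eqxx in t0.
  by rewrite /node /= mem_nth.
have rpath : path <%R 0 r.
  rewrite (@path_sortedE _ <%R) ?sort_lt_sorted ?undup_uniq ?andbT; last exact: lt_trans.
  by apply/allP => x /rpos/andP[].
exists r; split; first split => //.
- have lr : last 0 r \in r.
    by case: r tr {rpath memr rpos} => // y l _; rewrite /= mem_last.
  rewrite eq_le; apply/andP; split; first by have /andP[] := rpos _ lr.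
  move: rpath; move: tr => /path.splitPr => -[r1 r2].
  rewrite cat_path last_cat /= => /and3P[_ _ r2p].
  by apply: (@itv_partition_le _ _ _ _ r2); split.
- by move=> x xp; rewrite memr xp.
- by move=> x xq; rewrite memr xq orbT.
Qed.

Lemma sum_node (f : R -> R) a b p : itv_partition a b p ->
  \sum_(k < size p) (f (node a p k.+1) - f (node a p k)) = f b - f a.
Proof.
move=> abp; rewrite -[in RHS](node_last abp).
rewrite -(big_mkord xpredT (fun k => f (node a p k.+1) - f (node a p k))).
by rewrite telescope_sumr.
Qed.

(** On a partition containing [c] and [e], the increments between [c] and [e]
    are the increments of the function frozen outside of [c, e]. *)
Lemma sum_node_restrict (f : R -> R) a b p c e : itv_partition a b p ->
  c \in a :: p -> e \in a :: p -> c <= e ->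
  \sum_(k < size p) (c < node a p k.+1 <= e)%R%:R *
    (f (node a p k.+1) - f (node a p k)) = f e - f c.
Proof.
move=> abp cp ep ce.
pose g x := f (Num.min (Num.max x c) e).
have bounds x : x \in a :: p -> a <= x <= b.
  by move=> /mem_nodeP[k kp ->]; rewrite (node_leb abp kp) (node_le abp (leq0n k)).
have /andP[ac cb] := bounds _ cp; have /andP[ae eb] := bounds _ ep.
transitivity (g b - g a); last first.
  by rewrite /g (max_l cb) (max_r ac) (min_r eb) (min_l ce).
rewrite -(sum_node g abp); apply: eq_bigr => k _.
have kp := ltn_ord k; have kk := node_lt abp kp.
rewrite /g; have [h1|h1] := ltP c (node a p k.+1) => /=.
  have ck := node_gap abp kp cp h1.
  rewrite (max_l ck).
  have [h2|h2] := leP (node a p k.+1) e.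
    by rewrite mul1r (min_l (le_trans (ltW kk) h2)).
  have ek := node_gap abp kp ep h2.
  by rewrite mul0r (min_r ek) subrr.
by rewrite mul0r (max_r (le_trans (ltW kk) h1)) subrr.
Qed.

Lemma uniform_partition a b (m : R) : a <= b -> 0 < m ->
  exists2 p, itv_partition a b p &
    forall k, (k < size p)%N -> node a p k.+1 - node a p k < m.
Proof.
rewrite le_eqVlt => /predU1P[->|ab] m0.
  by exists [::] => //; split.
pose n := (Num.truncn ((b - a) / m)).+1.
have n0 : 0 < n%:R :> R by rewrite ltr0n.
have nm : (b - a) / n%:R < m.
  rewrite ltr_pdivrMr// mulrC -ltr_pdivrMr//.
  by rewrite /n; apply: Num.Theory.truncnS_gt.
pose p := mkseq (fun i => a + (b - a) * (i.+1)%:R / n%:R) n.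
have nodeE k : (k <= n)%N -> node a p k = a + (b - a) * k%:R / n%:R.
  case: k => [_|k kn]; first by rewrite /node /= mulr0 mul0r addr0.
  by rewrite /node /= nth_mkseq.
have step k : (k < n)%N -> node a p k.+1 - node a p k = (b - a) / n%:R.
  move=> kn; rewrite !nodeE//; last exact: ltnW.
  by rewrite -natr1; field; rewrite lt0r_neq0.
have sp : size p = n by rewrite size_mkseq.
exists p; last by move=> k; rewrite sp => kn; rewrite step.
split.
  apply/(pathP 0) => i; rewrite sp => ip.
  have := step _ ip; rewrite {2}/node => e; rewrite -subr_gt0.
  by rewrite [X in 0 < X]e divr_gt0// subr_gt0.
apply/eqP; rewrite (last_nth 0) -/(node a p (size p)) sp nodeE//.
by rewrite -mulrA divff ?mulr1 ?lt0r_neq0//; ring.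
Qed.

Local Notation mu := (@lebesgue_measure R).

(** The isometry yields a sum over the cells of a partition; this turns it into an
    integral over time, where the approximation errors live. *)
Lemma sum_node_le_integral a b p (c : nat -> \bar R) (f : R -> \bar R) :
  itv_partition a b p ->
  measurable_fun `]a, b] f -> (forall u, (a < u <= b)%R -> (0 <= f u)%E) ->
  (forall k, (k < size p)%N -> (0 <= c k)%E) ->
  (forall k u, (k < size p)%N -> node a p k < u <= node a p k.+1 ->
     (c k <= f u)%E) ->
  (\sum_(k < size p) c k * (node a p k.+1 - node a p k)%R%:E <=
   \int[mu]_(u in `]a, b]) f u)%E.
Proof.
move=> abp mf f0 c0 cf.
suff main n : (n <= size p)%N ->
    (\sum_(k < n) c k * (node a p k.+1 - node a p k)%R%:E <=
     \int[mu]_(u in `]a, node a p n]) f u)%E.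
  by have := main _ (leqnn _); rewrite (node_last abp).
elim: n => [_|n ih np].
  rewrite big_ord0; apply: integral_ge0 => u /=.
  by rewrite in_itv/= /node /= => /andP[/lt_le_trans/[apply]]; rewrite ltxx.
have nn := node_lt abp np.
have an : a <= node a p n by exact: (node_le abp (leq0n n) (ltnW np)).
have nb : node a p n.+1 <= b by exact: node_leb abp np.
have sub1 : `]a, node a p n] `<=` `]a, b].
  move=> u /=; rewrite !in_itv/= => /andP[-> /le_trans]; apply.
  exact: le_trans (ltW nn) nb.
have sub2 : `]node a p n, node a p n.+1] `<=` `]a, b].
  move=> u /=; rewrite !in_itv/= => /andP[h1 h2].
  by rewrite (le_lt_trans an h1) (le_trans h2 nb).
rewrite big_ord_recr/=.
have -> : (`]a, node a p n.+1] = `]a, node a p n] `|` `]node a p n, node a p n.+1])%classic.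
  by rewrite -itv_bndbnd_setU// bnd_simp// ltW.
rewrite ge0_integral_setU//=; last 3 first.
- apply: measurable_funS mf => //.
  by move=> u [/sub1|/sub2].
- by move=> u [/sub1|/sub2] /=; rewrite in_itv/=; exact: f0.
- apply/disj_setPS => u [] /=; rewrite !in_itv/= => /andP[_ h1] /andP[h2 _].
  by have := lt_le_trans h2 h1; rewrite ltxx.
apply: leeD; first exact: ih (ltnW np).
have -> : (node a p n.+1 - node a p n)%:E = mu `]node a p n, node a p n.+1].
  by rewrite lebesgue_measure_itv/= lte_fin nn EFinB.
rewrite -integral_cst//; apply: ge0_le_integral => //=.
- by move=> u _; exact: c0.
- exact: measurable_funS mf.
- by move=> u; rewrite in_itv/=; exact: cf.
Qed.

End partitions.

(** * Continuous processes and their time integrals *)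

Section joint_measurability.
Context d (T : measurableType d) (R : realType) (P : probability T R).
Variable X : R -> {RV P >-> R}.

(** The process frozen at the last point of the grid of mesh 1/(n+1), cut off at time
    n+1 so as to be a finite sum of products of measurable functions. *)
Let sample (n : nat) (z : measurableTypeR R * T) : R :=
  \sum_(k < n.+1 ^ 2) \1_`[k%:R / n.+1%:R, k.+1%:R / n.+1%:R[ z.1 *
    X (k%:R / n.+1%:R) z.2.

Let measurable_sample n : measurable_fun setT (sample n).
Proof.
apply: measurable_sum => k; apply: measurable_funM.
  by apply: measurableT_comp => //; exact: measurable_indic.
exact: measurableT_comp.
Qed.

Let sample_lt0 n u w : u < 0 -> sample n (u, w) = 0.
Proof.
move=> u0; rewrite /sample big1// => k _; rewrite indicE memNset ?mul0r//=.
rewrite in_itv/= => /andP[+ _]; apply/negP; rewrite -ltNge.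
by apply: (lt_le_trans u0); rewrite divr_ge0.
Qed.

Let sample_ge0 n u w : 0 <= u < n.+1%:R ->
  sample n (u, w) = X ((Num.truncn (u * n.+1%:R))%:R / n.+1%:R) w.
Proof.
move=> /andP[u0 un]; rewrite /sample.
have N0 : 0 < n.+1%:R :> R by rewrite ltr0n.
have uN0 : 0 <= u * n.+1%:R by rewrite mulr_ge0// ltW.
have kN : (Num.truncn (u * n.+1%:R) < n.+1 ^ 2)%N.
  rewrite -(ltr_nat R) natrX expr2; have /andP[h _] := Num.Theory.truncn_itv uN0.
  by apply: (le_lt_trans h); rewrite ltr_pM2r.
rewrite (bigD1 (Ordinal kN))//= big1 ?addr0.
  rewrite indicE mem_set ?mul1r//= in_itv/=.
  by rewrite ler_pdivrMr// ltr_pdivlMr//; exact: Num.Theory.truncn_itv.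
move=> k kneq; rewrite indicE memNset ?mul0r//= in_itv/=.
rewrite ler_pdivrMr// ltr_pdivlMr// -Num.Theory.truncn_eq//.
by apply: contra_neq_not kneq => /eqP e; apply: val_inj.
Qed.

(** The frozen processes converge along continuous paths. Paths in the exceptional
    event are set to 0, for the probability space need not be complete. *)
Lemma continuous_process_joint_measurable :
  {ae P, forall w, {within `[0, +oo[, continuous (fun t => X t w)}} ->
  exists Y : measurableTypeR R * T -> R, measurable_fun setT Y /\
    {ae P, forall w, forall u, 0 <= u -> Y (u, w) = X u w}.
Proof.
move=> [N [mN PN0 NX]].
pose Y (z : measurableTypeR R * T) : R :=
  (if 0 <= z.1 then X z.1 z.2 else 0) * \1_(~` N) z.2.
exists Y; split; last first.
  exists N; split => // w /= /existsNP[u /not_implyP[u0]].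
  apply: contra_notP => Nw; rewrite /Y /= u0 indicE mem_set ?mulr1//.
pose h n (z : measurableTypeR R * T) : R := sample n z * \1_(~` N) z.2.
apply: (@measurable_fun_cvg _ _ _ _ h).
  move=> n; apply: measurable_funM; first exact: measurable_sample.
  by apply: measurableT_comp => //; apply: measurable_indic; exact: measurableC.
move=> [u w] _; rewrite /h /Y /=.
have [Nw|Nw] := pselect (N w).
  rewrite indicE memNset; last by apply.
  rewrite mulr0; under eq_fun do rewrite mulr0; exact: cvg_cst.
rewrite indicE mem_set// mulr1; under eq_fun do rewrite mulr1.
have [u0|u0] := leP 0 u; last first.
  by under eq_fun do rewrite sample_lt0//; exact: cvg_cst.
have cX : {within `[0, +oo[, continuous (fun t => X t w)}.
  by apply: contrapT => h0; exact/Nw/NX.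
have /(_ u) := (subspace_continuousP _ _).1 cX.
rewrite /= in_itv/= u0 => /(_ isT) cXu.
apply/cvgrPdist_lt => e e0.
have /cvgrPdist_lt/(_ _ e0) := cXu.
rewrite near_withinE => -[r /= r0 ball_r].
near=> n.
have un : u < n.+1%:R.
  near: n; exists (Num.truncn u) => // n /= h1.
  apply: (lt_le_trans (Num.Theory.truncnS_gt u)); by rewrite ler_nat ltnS.
have nr : (n.+1%:R)^-1 < r by near: n; exact: near_infty_natSinv_lt (PosNum r0).
rewrite sample_ge0 ?u0//.
have N0 : 0 < n.+1%:R :> R by rewrite ltr0n.
have uN0 : 0 <= u * n.+1%:R by rewrite mulr_ge0// ltW.
have /andP[h1 h2] := Num.Theory.truncn_itv uN0.
apply: ball_r; last by rewrite /= in_itv/= andbT divr_ge0.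
rewrite /ball_/=; apply: le_lt_trans nr.
rewrite ger0_norm ?subr_ge0 ?ler_pdivrMr//.
by rewrite lerBlDr -[X in _ <= X + _]mul1r -mulrDl ler_pdivlMr// addrC natr1 ltW.
Unshelve. all: by end_near. Qed.

End joint_measurability.

Section time_integral.
Context d (T : measurableType d) (R : realType) (P : probability T R).
Variable X : R -> {RV P >-> R}.
Hypothesis cX :
  {ae P, forall w, {within `[0, +oo[, continuous (fun t => X t w)}}.
Local Notation mu := (@lebesgue_measure R).

(** Cauchy-Schwarz, as positivity of the integral of (f - m)^2 for [m] the
    mean value of [f]. *)
Lemma sqr_Rintegral_le (f : R -> R) (a b : R) : a < b ->
  mu.-integrable `]a, b] (EFin \o f) ->
  (((\int[mu]_(u in `]a, b]) f u) ^+ 2)%:E <=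
   (b - a)%:E * \int[mu]_(u in `]a, b]) (f u ^+ 2)%:E)%E.
Proof.
move=> ab iF; have ba0 : 0 < b - a by rewrite subr_gt0.
have muI : mu `]a, b] = (b - a)%:E by rewrite lebesgue_measure_itv/= lte_fin ab EFinB.
have mf := measurable_int _ iF.
have mI : measurable (`]a, b]%classic : set (measurableTypeR R)) by exact: measurable_itv.
have f20 : (0 <= \int[mu]_(u in `]a, b]) (f u ^+ 2)%:E)%E.
  by apply: integral_ge0 => u _; rewrite lee_fin sqr_ge0.
have mf2 : measurable_fun `]a, b] (fun u => (f u ^+ 2)%:E).
  by apply/measurable_EFinP; apply: measurable_funX; exact/measurable_EFinP.
have [foo|foo] := eqVneq (\int[mu]_(u in `]a, b]) (f u ^+ 2)%:E)%E +oo%E.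
  by rewrite foo gt0_muley ?lte_fin// leey.
have if2 : mu.-integrable `]a, b] (fun u => (f u ^+ 2)%:E).
  apply/integrableP; split => //.
  under eq_integral do rewrite gee0_abs ?lee_fin ?sqr_ge0//.
  by rewrite ltey.
pose I := \int[mu]_(u in `]a, b]) f u; pose m := I / (b - a).
pose Q := \int[mu]_(u in `]a, b]) (f u ^+ 2).
have icst c : mu.-integrable `]a, b] (EFin \o cst c).
  apply/integrableP; split; first exact/measurable_EFinP.
  under eq_integral do rewrite /=.
  rewrite -[X in (X < _)%E]/(\int[mu]_(u in `]a, b]) (cst `|c|%:E u))%E.
  by rewrite integral_cst// [X in (_ * X < _)%E]muI -EFinM ltry.
have : 0 <= \int[mu]_(u in `]a, b]) (f u ^+ 2 + (- (2 * m)) * f u + m ^+ 2).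
  apply: Rintegral_ge0 => u _.
  by rewrite (_ : _ + _ = (f u - m) ^+ 2) ?sqr_ge0//; ring.
have iZ : mu.-integrable `]a, b] (EFin \o (fun u => (- (2 * m)) * f u)).
  have h : mu.-integrable `]a, b] (fun u => (- (2 * m))%:E * (EFin \o f) u)%E.
    exact: integrableZl.
  by apply: eq_integrable h => // u _; rewrite /= EFinM.
rewrite RintegralD//; last 2 first.
- have h := integrableD mI if2 iZ.
  by apply: eq_integrable h => //.
- exact: icst.
rewrite RintegralD// RintegralZl// -/I -/Q Rintegral_cst//.
have -> : fine (mu `]a, b]) = b - a by rewrite muI.
have -> : Q + - (2 * m) * I + m ^+ 2 * (b - a) = Q - I ^+ 2 / (b - a).
  by rewrite /m; have := lt0r_neq0 ba0 => ?; field.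
rewrite subr_ge0 ler_pdivrMr// mulrC => h.
have -> : (\int[mu]_(u in `]a, b]) (f u ^+ 2)%:E)%E = Q%:E.
  by rewrite /Q /Rintegral fineK// ge0_fin_numE// ltey.
by rewrite -EFinM lee_fin.
Qed.

(** Cauchy-Schwarz on each path, then Tonelli for the jointly measurable version. *)
Lemma msq_time_integral (s t M : R) (J J' : {RV P >-> R}) : 0 <= s <= t ->
  (forall u, s <= u <= t -> (msq P (X u) <= M%:E)%E) ->
  {ae P, forall w, J w = \int[mu]_(u in `[0, t]) X u w} ->
  {ae P, forall w, J' w = \int[mu]_(u in `[0, s]) X u w} ->
  (msq P (fun w => (J w - J' w)%R) <= ((t - s) ^+ 2 * M)%:E)%E.
Proof.
move=> /andP[s0 st] XM Jt Js.
have mJ : measurable_fun setT (fun w => J w - J' w) by exact: measurable_funB.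
have M0 : 0 <= M.
  by rewrite -lee_fin (le_trans (msq_ge0 P (X t)))// XM// st lexx.
have [ts|ts] := eqVneq t s.
  have -> : ((t - s) ^+ 2 * M)%:E = msq P (cst 0).
    by rewrite msq_cst ts subrr expr0n mul0r.
  rewrite le_eqVlt; apply/orP; left; apply/eqP.
  apply: ae_eq_msq => //; rewrite ts in Jt.
  by apply: filterS2 Jt Js => w -> ->; rewrite subrr.
have {ts}st' : s < t by rewrite lt_neqAle eq_sym ts.
have [Y [mY YX]] := continuous_process_joint_measurable cX.
have mYu w : measurable_fun setT (fun u : measurableTypeR R => Y (u, w)).
  exact: measurableT_comp.
have mY2 : measurable_fun setT (fun z => (Y z ^+ 2)%:E).
  by apply/measurable_EFinP; exact: measurable_funX.
have JE : {ae P, forall w, ((J w - J' w) ^+ 2)%:E <=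
    (t - s)%:E * \int[mu]_(u in `]s, t]) (Y (u, w) ^+ 2)%:E}%E.
  apply: filterS2 (filterI Jt Js) (filterI YX cX) => w [-> ->] [Yw cw].
  have iX : mu.-integrable `[0, t] (EFin \o (fun u => X u w)).
    apply: continuous_compact_integrable; first exact: segment_compact.
    apply: continuous_subspaceW cw => u /=.
    by rewrite !in_itv/= => /andP[-> _].
  rewrite Rintegral_itvB//.
  rewrite (_ : (\int[mu]_(u in `]s, t]) (Y (u, w) ^+ 2)%:E)%E =
      (\int[mu]_(u in `]s, t]) (X u w ^+ 2)%:E)%E).
    apply: sqr_Rintegral_le => //; apply: integrableS iX => //.
    by move=> u /=; rewrite !in_itv/= => /andP[/ltW/(le_trans s0) -> ->].
  apply: eq_integral => u; rewrite inE/= in_itv/= => /andP[/ltW/(le_trans s0) u0 _].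
  by rewrite Yw.
pose F (z : measurableTypeR R * T) := ((\1_`]s, t] z.1)%:E * (Y z ^+ 2)%:E)%E.
have mF : measurable_fun setT F.
  apply: emeasurable_funM => //; apply/measurable_EFinP.
  by apply: measurableT_comp => //; exact: measurable_indic.
have F0 z : (0 <= F z)%E by rewrite mule_ge0// lee_fin ?sqr_ge0.
have FE w : (\int[mu]_(u in `]s, t]) (Y (u, w) ^+ 2)%:E =
    \int[mu]_u F (u, w))%E.
  rewrite integral_mkcond; apply: eq_integral => u _.
  by rewrite /F patchE indicE/=; case: ifPn; rewrite ?mul1e ?mul0e.
have mG : measurable_fun setT (fun w => \int[mu]_u F (u, w))%E.
  exact: (measurable_fun_fubini_tonelli_G F mF F0).
apply: (@le_trans _ _ (\int[P]_w ((t - s)%:E * \int[mu]_u F (u, w)))%E).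
  apply: ae_ge0_le_integral => //.
  - by move=> w _; rewrite lee_fin sqr_ge0.
  - exact: measurable_sqr_EFin.
  - move=> w _; rewrite mule_ge0 ?lee_fin ?subr_ge0//.
    by apply: integral_ge0.
  - exact: measurable_funeM.
  - by apply: filterS JE => w + _; rewrite FE.
rewrite ge0_integralZl//; last 2 first.
- by move=> w _; apply: integral_ge0.
- by rewrite lee_fin subr_ge0.
rewrite expr2 -mulrA EFinM lee_wpmul2l ?lee_fin ?subr_ge0//.
have /= := @fubini_tonelli _ _ _ _ R mu P F mF F0 => <-.
apply: (@le_trans _ _ (\int[mu]_(u in `]s, t]) (cst M%:E) u)%E).
  rewrite [leRHS]integral_mkcond; apply: ge0_le_integral => //.
  - by move=> u _; apply: integral_ge0.
  - exact: (measurable_fun_fubini_tonelli_F F mF F0).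
  - apply/(measurable_restrictT _ _).1 => //; exact: measurable_cst.
  - move=> u _; rewrite patchE; case: ifPn; last first.
      move=> uI; rewrite /F integral0_eq// => w _ /=.
      by rewrite indicE (negbTE uI) mul0e.
    move=> uI; apply: (@le_trans _ _ (msq P (X u))).
      rewrite le_eqVlt; apply/orP; left; apply/eqP.
      rewrite /F /msq; apply: ae_eq_integral => //.
      + exact: (measurableT_comp mF).
      + exact: measurable_sqr_EFin.
      move: uI; rewrite inE/= in_itv/= => /andP[su ut].
      apply: filterS YX => w Yw _ /=.
      by rewrite Yw ?(le_trans s0 (ltW su))// indicE mem_set ?mul1e//= in_itv/= su.
    by apply: XM; move: uI; rewrite inE/= in_itv/= => /andP[/ltW -> ->].
rewrite integral_cst//.
have mu_st : mu `]s, t] = (t - s)%:E.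
  by rewrite lebesgue_measure_itv/= lte_fin st' EFinB.
by rewrite [X in (_ * X)%E]mu_st -EFinM lee_fin mulrC.
Qed.

End time_integral.

(** * Simple integrands *)

Section ito.
Context d (T : measurableType d) (R : realType) (P : probability T R).
Variables B Y : R -> {RV P >-> R}.
Hypothesis bB : brownian_motion B.
Hypothesis cY :
  {ae P, forall w, {within `[0, +oo[, continuous (fun t => Y t w)}}.
Local Notation mu := (@lebesgue_measure R).
Implicit Types (p q : seq R) (xi : nat -> T -> R).

(** Each [xi j] multiplies an increment of [B] that telescopes over the cells of the
    finer partition [q]. *)
Lemma simple_integral_refine t u p q xi w : itv_partition 0 u p ->
  itv_partition 0 t q -> {subset p <= q} ->
  simple_integral B p xi w =
  \sum_(k < size q) simple_value p xi (node 0 q k.+1) w *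
    increment B (node 0 q k) (node 0 q k.+1) w.
Proof.
move=> pu qt pq; have pq' x : x \in 0 :: p -> x \in 0 :: q.
  by rewrite !inE => /orP[->//|/pq ->]; rewrite orbT.
rewrite /simple_value; under [RHS]eq_bigr do rewrite mulr_suml.
rewrite exchange_big /=; apply: eq_bigr => j _; have jp := ltn_ord j.
under eq_bigr do rewrite -mulrA; rewrite -mulr_sumr; congr (_ * _).
rewrite (sum_node_restrict (fun x => B x w) qt)//.
- by apply: pq'; apply: mem_node; exact: ltnW.
- by apply: pq'; exact: mem_node.
- exact/ltW/(node_lt pu).
Qed.

Lemma simple_value_cell t p q xi k u w v : itv_partition 0 v p ->
  itv_partition 0 t q -> {subset p <= q} -> (k < size q)%N ->
  node 0 q k < u <= node 0 q k.+1 ->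
  simple_value p xi u w = simple_value p xi (node 0 q k.+1) w.
Proof.
move=> pv qt pq kq /andP[ku uk]; have pq' x : x \in 0 :: p -> x \in 0 :: q.
  by rewrite !inE => /orP[->//|/pq ->]; rewrite orbT.
apply: eq_bigr => j _; have jp := ltn_ord j; congr (_ * (nat_of_bool _)%:R).
have gap x : x \in 0 :: p -> x < node 0 q k.+1 -> x <= node 0 q k.
  by move=> /pq' xq; exact: node_gap qt kq xq.
have jm : Defs.point p j \in 0 :: p by apply: mem_node; exact: ltnW.
have j1m : Defs.point p j.+1 \in 0 :: p by exact: mem_node.
congr andb.
- apply/idP/idP => [/lt_le_trans|/(gap _ jm)/le_lt_trans]; exact.
- apply/idP/idP => [h|/(le_trans uk)//].
  rewrite leNgt; apply/negP => /(gap _ j1m) h2.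
  by have := lt_le_trans ku (le_trans h h2); rewrite ltxx.
Qed.

(** The [xi j] that are active on a cell of [q] are known at the left end of their own
    cell, which does not come after that of the cell of [q]. *)
Lemma simple_value_adapted t u p q xi k : simple_integrand B u p xi ->
  itv_partition 0 t q -> {subset p <= q} -> (k < size q)%N ->
  adapted B (node 0 q k) (simple_value p xi (node 0 q k.+1)).
Proof.
move=> [pu xiP] qt pq kq; have pq' x : x \in 0 :: p -> x \in 0 :: q.
  by rewrite !inE => /orP[->//|/pq ->]; rewrite orbT.
apply: measurable_sum => j; have jp := ltn_ord j.
have [pj|pj] := boolP (Defs.point p j < node 0 q k.+1); last first.
  rewrite (_ : (fun _ => _) = cst 0); first exact: measurable_cst.
  by apply/funext => w; rewrite mulr0.
apply: measurable_funM; last exact: measurable_cst.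
have [_ axi] := xiP _ jp.
apply: (@adapted_le _ _ _ _ _ (Defs.point p j)).
  apply: (node_gap qt kq) pj; apply: pq'; apply: mem_node; exact: ltnW.
by move=> _ D mD; rewrite setTI; exact: axi.
Qed.

Lemma simple_value_bounded u p xi v : simple_integrand B u p xi ->
  exists M : R, forall w, `|simple_value p xi v w| <= M.
Proof.
move=> [pu xiP].
have /choice[M MP] (j : 'I_(size p)) : exists m, forall w, `|xi j w| <= m.
  by have [] := xiP _ (ltn_ord j).
exists (\sum_(j < size p) M j) => w.
apply: (le_trans (ler_norm_sum _ _ _)); apply: ler_sum => j _.
rewrite normrM; apply: le_trans (MP j w).
by rewrite ler_piMr ?normr_ge0//; case: (_ && _); rewrite ?normr1 ?normr0.
Qed.

Lemma simple_integrand_measurable u p xi j : simple_integrand B u p xi ->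
  (j < size p)%N -> measurable_fun setT (xi j).
Proof.
move=> [pu xiP] jp; have [_ axi] := xiP _ jp.
apply: (@adapted_measurable _ _ _ _ B (Defs.point p j)).
by move=> _ D mD; rewrite setTI; exact: axi.
Qed.

Lemma simple_value_measurable u p xi v : simple_integrand B u p xi ->
  measurable_fun setT (simple_value p xi v).
Proof.
move=> sxi; apply: measurable_sum => j; apply: measurable_funM => //.
exact: simple_integrand_measurable sxi _.
Qed.

Lemma simple_integral_measurable u p xi : simple_integrand B u p xi ->
  measurable_fun setT (simple_integral B p xi).
Proof.
move=> sxi; apply: measurable_sum => j; apply: measurable_funM => //.
  exact: simple_integrand_measurable sxi _.
exact: measurable_increment.
Qed.

Lemma simple_value_after u p xi v w : itv_partition 0 u p -> u < v ->
  simple_value p xi v w = 0.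
Proof.
move=> pu uv; rewrite /simple_value big1// => j _; have jp := ltn_ord j.
rewrite [X in (_ && X)](_ : _ = false) ?andbF ?mulr0//.
apply/negbTE; rewrite -ltNge; apply: le_lt_trans uv; exact: node_leb pu jp.
Qed.

Definition ito_error p xi u := msq P (fun w => simple_value p xi u w - Y u w).

(** Tonelli for the jointly measurable version of [Y]. Measurability in time is what
    allows the errors of two approximations to be added under the integral. *)
Lemma measurable_ito_error t u p xi : simple_integrand B u p xi ->
  measurable_fun (`[0, t]%classic : set (measurableTypeR R)) (ito_error p xi).
Proof.
move=> sxi; have [Z [mZ ZY]] := continuous_process_joint_measurable cY.
pose F (z : measurableTypeR R * T) := ((simple_value p xi z.1 z.2 - Z z) ^+ 2)%:E.
have mF : measurable_fun setT F.
  apply/measurable_EFinP; apply: measurable_funX; apply: measurable_funB => //.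
  apply: measurable_sum => j; apply: measurable_funM.
    apply: measurableT_comp => //; exact: simple_integrand_measurable sxi _.
  rewrite (_ : (fun _ => _) = (\1_`]Defs.point p j, Defs.point p j.+1] \o fst)).
    by apply: measurableT_comp => //; exact: measurable_indic.
  apply/funext => z; rewrite /= indicE; congr (nat_of_bool _)%:R.
  by apply/idP/idP; rewrite inE/= in_itv.
have F0 z : (0 <= F z)%E by rewrite lee_fin sqr_ge0.
apply: (@eq_measurable_fun _ _ _ _ _ (fubini_F P F)); last first.
  by apply: measurable_funTS; exact: (measurable_fun_fubini_tonelli_F F mF F0).
move=> v; rewrite inE/= in_itv/= => /andP[v0 _].
rewrite /fubini_F /ito_error /msq; apply: ae_eq_integral => //.
- exact: (measurableT_comp mF).
- apply: measurable_sqr_EFin; apply: measurable_funB => //.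
  exact: simple_value_measurable sxi.
- by apply: filterS ZY => w Zw _; rewrite /F/= Zw.
Qed.

(** The inequality part of the Ito isometry, on a common refinement of the two
    partitions. Up to time [s] the two integrands differ by their errors; from [s] on
    only the first is left, and it is [Y] up to its error. *)
Lemma msq_simple_integralB s t (M : R) p q xi eta : 0 <= s <= t ->
  (forall u, 0 <= u <= t -> (msq P (Y u) <= M%:E)%E) ->
  simple_integrand B t p xi -> simple_integrand B s q eta ->
  (msq P (fun w => (simple_integral B p xi w - simple_integral B q eta w)%R) <=
   16%:E * (\int[mu]_(u in `[0%R, t]) ito_error p xi u +
            \int[mu]_(u in `[0%R, s]) ito_error q eta u + (M * (t - s))%:E))%E.
Proof.
move=> /andP[s0 st] YM sxi seta.
have [pt xiP] := sxi; have [qs etaP] := seta.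
have M0 : 0 <= M.
  by rewrite -lee_fin (le_trans (msq_ge0 P (Y t)))// YM// lexx (le_trans s0).
have [r [rt pr qr]] := common_refinement st pt qs.
pose x := node 0 r.
pose g k w := simple_value p xi (x k.+1) w - simple_value q eta (x k.+1) w.
have -> : (fun w => simple_integral B p xi w - simple_integral B q eta w) =
    (fun w => \sum_(k < size r) g k w * idfun (increment B (x k) (x k.+1) w)).
  apply/funext => w.
  rewrite (simple_integral_refine _ _ pt rt pr) (simple_integral_refine _ _ qs rt qr).
  by rewrite -sumrB; apply: eq_bigr => k _; rewrite -mulrBl.
have x0 k : (k < size r)%N -> 0 <= x k < x k.+1.
  by move=> kr; rewrite (node_ge0 rt (ltnW kr)) (node_lt rt).
rewrite (@msq_sum_increments _ _ _ _ _ bB x (size r) g (fun _ => idfun)); last first.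
- by move=> k kr; exact/(mean_increment bB)/x0.
- move=> k kr; have /andP[xk xk1] := x0 _ kr.
  by have [] := square_integrable_increment bB xk (ltW xk1).
- by move=> k; exact: measurable_id.
- move=> k kr.
  have [M1 M1P] := simple_value_bounded (x k.+1) sxi.
  have [M2 M2P] := simple_value_bounded (x k.+1) seta.
  by exists (M1 + M2) => w; rewrite (le_trans (ler_normB _ _))// lerD.
- move=> k kr; apply: measurable_funB.
    exact: simple_value_adapted sxi rt pr kr.
  exact: simple_value_adapted seta rt qr kr.
- by move=> k /x0/andP[-> /ltW].
have mg k : measurable_fun setT (g k).
  by apply: measurable_funB; [exact: simple_value_measurable sxi|
    exact: simple_value_measurable seta].
pose b u := (2%:E * (ito_error p xi u + if (u <= s)%R then ito_error q eta u else M%:E))%E.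
have e0 p' xi' u : (0 <= ito_error p' xi' u)%E by exact: msq_ge0.
have if0 u : (0 <= if (u <= s)%R then ito_error q eta u else M%:E)%E.
  by case: ifP.
have mp v : measurable_fun (`]0, v]%classic : set (measurableTypeR R)) (ito_error p xi).
  apply: measurable_funS (measurable_ito_error (t:=v) sxi) => //.
  by move=> u /=; rewrite !in_itv/= => /andP[/ltW -> ->].
have mq v : measurable_fun (`]0, v]%classic : set (measurableTypeR R)) (ito_error q eta).
  apply: measurable_funS (measurable_ito_error (t:=v) seta) => //.
  by move=> u /=; rewrite !in_itv/= => /andP[/ltW -> ->].
have mif : measurable_fun (`]0, t]%classic : set (measurableTypeR R))
    (fun u => if (u <= s)%R then ito_error q eta u else M%:E).
  apply: measurable_fun_if => //.
  - by apply: measurable_fun_ler.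
  - by apply: measurable_funS (mq t) => //; exact: subIsetl.
apply: (@le_trans _ _ (8%:E * \sum_(k < size r) msq P (g k) * (x k.+1 - x k)%R%:E)%E).
  rewrite ge0_sume_distrr; last first.
    move=> k _; rewrite mule_ge0 ?msq_ge0// lee_fin subr_ge0.
    by case/andP: (x0 _ (ltn_ord k)) => _ /ltW.
  apply: lee_sum => k _; rewrite muleCA -EFinM lee_wpmul2l ?msq_ge0//.
  by have /andP[xk /ltW xk1] := x0 _ (ltn_ord k); exact: msq_increment.
have key : (\sum_(k < size r) msq P (g k) * (x k.+1 - x k)%R%:E <=
    \int[mu]_(u in `]0%R, t]) b u)%E.
  apply: (@sum_node_le_integral R 0 t r (fun k => msq P (g k)) b rt).
  - rewrite /b; apply: measurable_funeM; apply: emeasurable_funD; [exact: mp|exact: mif].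
  - by move=> u _; rewrite mule_ge0// adde_ge0.
  - by move=> k _; exact: msq_ge0.
  - move=> k u kr /[dup] /andP[xu ux] cell.
    have u0 : 0 <= u by rewrite ltW// (le_lt_trans _ xu)// (node_ge0 rt (ltnW kr)).
    have ut : u <= t by rewrite (le_trans ux)// (node_leb rt kr).
    have mpY : measurable_fun setT (fun w => simple_value p xi u w - Y u w).
      by apply: measurable_funB => //; exact: simple_value_measurable sxi.
    have mqY : measurable_fun setT (fun w => simple_value q eta u w - Y u w).
      by apply: measurable_funB => //; exact: simple_value_measurable seta.
    have gE w : g k w = simple_value p xi u w - simple_value q eta u w.
      by rewrite (simple_value_cell _ _ pt rt pr kr cell)
        (simple_value_cell _ _ qs rt qr kr cell).
    rewrite /b; case: ifPn => [us|]; last rewrite -ltNge => su.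
    + rewrite /ito_error -[X in (_ + X)%E]mul1e.
      have -> : 1%E = ((-1) ^+ 2)%:E :> \bar R by rewrite sqrrN expr1n.
      rewrite -msqZ//.
      apply: le_trans (msqD_le _ _ _) => //; last first.
        by apply: measurable_funM => //; exact: measurable_cst.
      rewrite le_eqVlt; apply/orP; left; apply/eqP; congr (msq P _).
      by apply/funext => w; rewrite gE; ring.
    + apply: (@le_trans _ _ (2%:E * (ito_error p xi u + msq P (Y u)))%E).
        apply: le_trans (msqD_le _ _ _) => //.
        rewrite le_eqVlt; apply/orP; left; apply/eqP; congr (msq P _).
        by apply/funext => w; rewrite gE (simple_value_after _ _ qs su); ring.
      by rewrite lee_wpmul2l// leeD2l// YM// u0.
rewrite (_ : 16%:E = 8%:E * 2%:E)%E; last by rewrite -EFinM; congr EFin; ring.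
rewrite -muleA lee_wpmul2l//; apply: (le_trans key).
rewrite ge0_integralZl//; last 2 first.
- by apply: emeasurable_funD; [exact: mp|exact: mif].
- by move=> u _; rewrite adde_ge0.
rewrite lee_wpmul2l// ge0_integralD//.
rewrite -addeA leeD//.
  apply: ge0_subset_integral => //; first exact: measurable_ito_error sxi.
  by move=> u /=; rewrite !in_itv/= => /andP[/ltW -> ->].
have tI : `]0, t]%classic = (`]0, s] `|` `]s, t])%classic.
  by rewrite -itv_bndbnd_setU// bnd_simp.
have sub1 : `]0, s] `<=` `]0, t].
  by move=> u /=; rewrite !in_itv/= => /andP[-> /le_trans]; apply.
have sub2 : `]s, t] `<=` `]0, t].
  by move=> u /=; rewrite !in_itv/= => /andP[/(le_lt_trans s0) -> ->].
rewrite [X in (\int[mu]_(_ in X) _)%E]tI ge0_integral_setU//=; last 2 first.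
- by rewrite -tI.
- apply/disj_setPS => u [] /=; rewrite !in_itv/= => /andP[_ h1] /andP[h2 _].
  by have := lt_le_trans h2 h1; rewrite ltxx.
apply: leeD.
  have -> : (\int[mu]_(u in `]0%R, s]) (if (u <= s)%R then ito_error q eta u else M%:E) =
      \int[mu]_(u in `]0%R, s]) ito_error q eta u)%E.
    by apply: eq_integral => u; rewrite inE/= in_itv/= => /andP[_ ->].
  apply: ge0_subset_integral => //; first exact: measurable_ito_error seta.
  by move=> u /=; rewrite !in_itv/= => /andP[/ltW -> ->].
have -> : (\int[mu]_(u in `]s, t]) (if (u <= s)%R then ito_error q eta u else M%:E) =
    \int[mu]_(u in `]s, t]) (cst M%:E) u)%E.
  apply: eq_integral => u; rewrite inE/= in_itv/= => /andP[su _].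
  by rewrite leNgt su.
have mu_st : mu `]s, t] = (t - s)%:E.
  rewrite lebesgue_measure_itv/= lte_fin; have [->|ts] := eqVneq s t.
    by rewrite ltxx subrr.
  by rewrite lt_neqAle ts st EFinB.
by rewrite integral_cst// [X in (_ * X)%E]mu_st -EFinM.
Qed.

End ito.

(** * Ito integrals *)

Section ito_integral.
Context d (T : measurableType d) (R : realType) (P : probability T R).
Variables B Y : R -> {RV P >-> R}.
Hypothesis bB : brownian_motion B.
Hypothesis cY :
  {ae P, forall w, {within `[0, +oo[, continuous (fun t => Y t w)}}.

Lemma ereal_cvg0_le (f : nat -> \bar R) (e : R) : 0 < e ->
  f n @[n --> \oo] --> 0%E -> \forall n \near \oo, (f n <= e%:E)%E.
Proof.
move=> e0 f0; have : \forall y \near (0 : \bar R)%E, (y <= e%:E)%E.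
  have : (0 < e%:E :> \bar R)%E by rewrite lte_fin.
  by move=> /open_ereal_lt'; apply: filterS => y /ltW.
exact: f0.
Qed.

(** Passage to the limit in [msq_simple_integralB]. *)
Lemma msq_ito_increment s t (M : R) (J J' : {RV P >-> R}) : 0 <= s <= t ->
  (forall u, 0 <= u <= t -> (msq P (Y u) <= M%:E)%E) ->
  ito_integral B Y t J -> ito_integral B Y s J' ->
  (msq P (fun w => (J w - J' w)%R) <= (32 * (M * (t - s)))%:E)%E.
Proof.
move=> st YM [p [xi [sxi exi eJ]]] [q [eta [seta eeta eJ']]].
apply/lee_addgt0Pr => e e0.
(* Below, 2 (16 * 2 + 2 * 2) = 72 copies of e' are spent. *)
pose e' := e / 72; have e'0 : 0 < e' by rewrite divr_gt0.
near \oo => n.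
have := msq_simple_integralB bB cY st YM (sxi n) (seta n).
set D := msq P _ => DM.
have mS := simple_integral_measurable (sxi n).
have mS' := simple_integral_measurable (seta n).
have h1 : (\int[lebesgue_measure]_(u in `[0%R, t]) ito_error Y (p n) (xi n) u <= e'%:E)%E.
  near: n; have := ereal_cvg0_le e'0 exi; apply: filterS => n.
  by under eq_integral do rewrite unlock.
have h2 : (\int[lebesgue_measure]_(u in `[0%R, s]) ito_error Y (q n) (eta n) u <= e'%:E)%E.
  near: n; have := ereal_cvg0_le e'0 eeta; apply: filterS => n.
  by under eq_integral do rewrite unlock.
have h3 : (msq P (fun w => (simple_integral B (p n) (xi n) w - J w)%R) <= e'%:E)%E.
  by near: n; have := ereal_cvg0_le e'0 eJ; apply: filterS => n; rewrite unlock.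
have h4 : (msq P (fun w => (simple_integral B (q n) (eta n) w - J' w)%R) <= e'%:E)%E.
  by near: n; have := ereal_cvg0_le e'0 eJ'; apply: filterS => n; rewrite unlock.
have mSJ : measurable_fun setT (fun w => simple_integral B (p n) (xi n) w - J w).
  exact: measurable_funB.
have mSJ' : measurable_fun setT (fun w => simple_integral B (q n) (eta n) w - J' w).
  exact: measurable_funB.
have mN : measurable_fun setT (fun w => -1 * (simple_integral B (p n) (xi n) w - J w)).
  by apply: measurable_funM => //; exact: measurable_cst.
have Jsplit : (fun w => J w - J' w) = fun w =>
    (simple_integral B (p n) (xi n) w - simple_integral B (q n) (eta n) w) +
    (-1 * (simple_integral B (p n) (xi n) w - J w) +
     (simple_integral B (q n) (eta n) w - J' w)).
  by apply/funext => w; ring.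
have : (msq P (fun w => (J w - J' w)%R) <= 2%:E * (D + 2%:E * (e'%:E + e'%:E)))%E.
  rewrite Jsplit; apply: le_trans (msqD_le _ _ _) _.
  - exact: measurable_funB.
  - exact: measurable_funD.
  rewrite lee_wpmul2l// leeD2l//; apply: le_trans (msqD_le _ mN mSJ') _.
  by rewrite lee_wpmul2l// leeD// msqZ// sqrrN expr1n mul1e.
move=> /le_trans; apply.
apply: (@le_trans _ _ (2%:E * (16%:E * (e'%:E + e'%:E + (M * (t - s))%:E) +
    2%:E * (e'%:E + e'%:E)))%E).
  rewrite lee_wpmul2l// leeD2r//; apply: (le_trans DM).
  by rewrite lee_wpmul2l// leeD2r// leeD.
rewrite -!(EFinD, EFinM) lee_fin /e'; lra.
Unshelve. all: by end_near. Qed.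

(** With this the bound on increments, taken from time 0, bounds the integral itself. *)
Lemma ito_integral0 : ito_integral B Y 0 (cst 0).
Proof.
exists (fun=> [::]), (fun _ _ => cst 0); split.
- by move=> n; split => //; split.
- rewrite [X in X @ _](_ : _ = fun=> 0%E); first exact: cvg_cst.
  by apply/funext => n; rewrite set_itv1 integral_set1.
- rewrite [X in X @ _](_ : _ = fun=> 0%E); first exact: cvg_cst.
  apply/funext => n; rewrite unlock integral0_eq// => w _.
  by rewrite /simple_integral big_ord0 subrr expr0n.
Qed.

End ito_integral.

(** * Quadratic covariation with Brownian motion *)

Section covariation.
Context d (T : measurableType d) (R : realType) (P : probability T R).

Lemma sum_node_cat (f : R -> R -> R) (a : R) p q :
  \sum_(k < size (p ++ q)) f (node a (p ++ q) k) (node a (p ++ q) k.+1) =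
  \sum_(k < size p) f (node a p k) (node a p k.+1) +
  \sum_(k < size q) f (node (last a p) q k) (node (last a p) q k.+1).
Proof.
elim: p a => [|x p ih] a; first by rewrite /= big_ord0 add0r.
by rewrite /= !big_ord_recl /= -addrA -ih.
Qed.

Lemma cauchy_schwarz_sum n (a b : 'I_n -> R) :
  (\sum_(k < n) a k * b k) ^+ 2 <=
  (\sum_(k < n) a k ^+ 2) * (\sum_(k < n) b k ^+ 2).
Proof.
elim: n a b => [|n ih] a b; first by rewrite !big_ord0 expr0n mul0r.
rewrite !big_ord_recr/=.
set S := \sum_(k < n) _; set A := \sum_(k < n) _; set D := \sum_(k < n) _.
set x := a ord_max; set y := b ord_max.
have SAD : S ^+ 2 <= A * D by exact: (ih (a \o widen_ord (leqnSn n)) (b \o widen_ord (leqnSn n))).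
have A0 : 0 <= A by apply: sumr_ge0 => k _; exact: sqr_ge0.
have D0 : 0 <= D by apply: sumr_ge0 => k _; exact: sqr_ge0.
have Y0 : 0 <= A * y ^+ 2 + D * x ^+ 2 by rewrite addr_ge0// mulr_ge0// sqr_ge0.
have cross : 2 * S * (x * y) <= A * y ^+ 2 + D * x ^+ 2.
  apply: (le_trans (ler_norm _)); rewrite -[leRHS]ger0_norm//.
  rewrite -ler_sqr ?nnegrE ?normr_ge0// !real_normK ?num_real//.
  have -> : (2 * S * (x * y)) ^+ 2 = 4 * (x * y) ^+ 2 * S ^+ 2 by ring.
  apply: (@le_trans _ _ (4 * (x * y) ^+ 2 * (A * D))).
    by rewrite ler_wpM2l// mulr_ge0// sqr_ge0.
  rewrite -subr_ge0 [X in 0 <= X](_ : _ = (A * y ^+ 2 - D * x ^+ 2) ^+ 2).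
    exact: sqr_ge0.
  by ring.
have -> : (S + x * y) ^+ 2 = S ^+ 2 + 2 * S * (x * y) + (x * y) ^+ 2 by ring.
have -> : (A + x ^+ 2) * (D + y ^+ 2) =
  A * D + (A * y ^+ 2 + D * x ^+ 2) + (x * y) ^+ 2 by ring.
by rewrite lerD2r lerD.
Qed.

(** Convergence in probability says nothing on an event of small probability, where a
    truncated square contributes at most [M] times that probability. The truncation is
    removed by monotone convergence. *)
Lemma msq_truncation (U : T -> R) (c : \bar R) : measurable_fun setT U ->
  (forall M : R, 0 < M -> (\int[P]_w (Num.min (U w ^+ 2) M)%:E <= c)%E) ->
  (msq P U <= c)%E.
Proof.
move=> mU Uc.
have mU2 : measurable_fun setT (fun w => U w ^+ 2) by exact: measurable_funX.
have lim_min w : (Num.min (U w ^+ 2) n%:R)%:E @[n --> \oo] --> (U w ^+ 2)%:E.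
  apply: cvg_near_cst; exists (Num.truncn (U w ^+ 2)).+1 => // n /= h.
  rewrite min_l// ltW// (lt_le_trans (Num.Theory.truncnS_gt _))//.
  by rewrite ler_nat.
have conv : (\int[P]_w (Num.min (U w ^+ 2) n%:R)%:E)%E @[n --> \oo] --> msq P U.
  rewrite /msq [X in _ --> X](_ : _ =
      \int[P]_w limn (fun n => (Num.min (U w ^+ 2) n%:R)%:E))%E; last first.
    by apply: eq_integral => w _; apply/esym/cvg_lim => //; exact: lim_min.
  apply: (@cvg_monotone_convergence _ T R P setT measurableT
    (fun n w => (Num.min (U w ^+ 2) n%:R)%:E)) => //.
  - by move=> n; apply/measurable_EFinP; apply: measurable_minr.
  - by move=> n w _; rewrite lee_fin le_min sqr_ge0/=.
  - by move=> w _ m n mn; rewrite lee_fin le_min ge_min lexx/= ge_min ler_nat mn orbT.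
apply: (cvge_le _ conv); exists 1%N => // n /= n1; apply: Uc.
by rewrite ltr0n.
Qed.

Variable B : R -> {RV P >-> R}.
Hypothesis bB : brownian_motion B.

Lemma quadratic_variation_bound (s t e : R) : 0 <= s <= t -> 0 < e ->
  exists2 m : R, 0 < m & forall p, itv_partition s t p ->
    (forall k, (k < size p)%N -> node s p k.+1 - node s p k < m) ->
    exists A, [/\ measurable A, (P A <= e%:E)%E & forall w, ~ A w ->
      \sum_(k < size p) increment B (node s p k) (node s p k.+1) w ^+ 2 <=
      9 * (t - s)].
Proof.
move=> /andP[s0]; rewrite le_eqVlt => /predU1P[<- e0|st e0].
  exists 1 => // p /itv_partitionxx -> _; exists set0; split => //.
    by rewrite measure0 lee_fin ltW.
  by move=> w _; rewrite big_ord0 subrr mulr0.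
have L0 : 0 < t - s by rewrite subr_gt0.
exists (e * (t - s) / 384); first by rewrite divr_gt0// mulr_gt0.
move=> p pst mesh.
exists [set w | 9 * (t - s) <=
  \sum_(k < size p) increment B (node s p k) (node s p k.+1) w ^+ 2]; split.
- rewrite -[X in measurable X]setTI; apply: measurable_fun_le => //.
  apply: measurable_sum => k; apply: measurable_funX; exact: measurable_increment.
- apply: le_trans (@quadratic_variation_tail _ _ _ _ _ bB (node s p) (size p)
    (e * (t - s) / 384) (t - s) _ _ _ L0) _.
  + move=> k kp; rewrite (node_lt pst kp) andbT.
    exact: le_trans s0 (node_le pst (leq0n k) (ltnW kp)).
  + by move=> k kp; rewrite ltW// mesh.
  + by rewrite (node_last pst).
  + rewrite lee_fin le_eqVlt; apply/orP; left; apply/eqP.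
    by have := lt0r_neq0 L0 => ?; field.
- by move=> w /= /negP; rewrite -ltNge => /ltW.
Qed.

(** Outside of an event of small probability, [Q - Q'] is close to the sum R of the
    products of increments over a fine partition of [s, t], and by Cauchy-Schwarz R^2 is
    at most 9 (t - s) times the sum of the squared increments of [Y]. *)
Lemma msq_covariation_increment (Y : R -> {RV P >-> R}) (s t K : R)
    (Q Q' : {RV P >-> R}) : 0 <= s <= t -> 0 <= K ->
  (forall u v, s <= u -> u <= v -> v <= t ->
     (msq P (increment Y u v) <= (K * (v - u))%:E)%E) ->
  quadratic_covariation B Y t Q -> quadratic_covariation B Y s Q' ->
  (msq P (fun w => (Q w - Q' w)%R) <= (18 * (K * (t - s) ^+ 2))%:E)%E.
Proof.
move=> /andP[s0 st] K0 YK cQ cQ'.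
have mD : measurable_fun setT (fun w => Q w - Q' w) by exact: measurable_funB.
apply: msq_truncation => // M M0; apply/lee_addgt0Pr => a a0.
(* As e <= 1, the error 8 e^2 + 3 e M found below is at most e (8 + 3 M) <= a. *)
pose e := Num.min 1 (a / (8 + 3 * M)).
have aM0 : 0 < 8 + 3 * M by rewrite addr_gt0// mulr_gt0.
have e0 : 0 < e by rewrite lt_min ltr01 divr_gt0.
have ea : 8 * e ^+ 2 + 3 * e * M <= a.
  have e1 : e <= 1 by rewrite ge_min lexx.
  have : e * (8 + 3 * M) <= a by rewrite -ler_pdivlMr// ge_min lexx orbT.
  by apply: le_trans; nra.
have [m1 m10 cQm] := cQ _ _ e0 e0.
have [m2 m20 cQ'm] := cQ' _ _ e0 e0.
have [m3 m30 qvm] := quadratic_variation_bound (introT andP (conj s0 st)) e0.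
pose m := Num.min (Num.min m1 m2) m3.
have m0 : 0 < m by rewrite !lt_min m10 m20.
have mm1 : m <= m1 by rewrite /m !ge_min lexx.
have mm2 : m <= m2 by rewrite /m !ge_min lexx orbT.
have mm3 : m <= m3 by rewrite /m !ge_min lexx !orbT.
have [p ps pm] := uniform_partition s0 m0.
have [q qt qm] := uniform_partition st m0.
have lp : last 0 p = s by case: ps => _ /eqP.
have pq : itv_partition 0 t (p ++ q) := itv_partition_cat ps qt.
pose Rs r a w := \sum_(k < size r)
  increment Y (node a r k) (node a r k.+1) w *
  increment B (node a r k) (node a r k.+1) w.
have mRs r b : measurable_fun setT (Rs r b).
  by apply: measurable_sum => k; apply: measurable_funM; exact: measurable_increment.
have Rcat w : Rs (p ++ q) 0 w = Rs p 0 w + Rs q s w.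
  by rewrite /Rs (sum_node_cat (fun x y => increment Y x y w * increment B x y w)) lp.
pose A1 := [set w | e <= `|Rs (p ++ q) 0 w - Q w|].
pose A2 := [set w | e <= `|Rs p 0 w - Q' w|].
have [A3 [mA3 PA3 qv]] := qvm q qt (fun k kq => lt_le_trans (qm k kq) mm3).
have mA r V : measurable [set w | e <= `|Rs r 0 w - (V : {RV P >-> R}) w|].
  rewrite -[X in measurable X]setTI; apply: measurable_fun_le => //.
  by apply: measurableT_comp => //; exact: measurable_funB.
have PA1 : (P A1 <= e%:E)%E.
  apply: cQm => // k; rewrite size_cat => kpq.
  have [kp|kp] := ltnP k (size p).
    apply: lt_le_trans mm1; apply: le_lt_trans (pm _ kp).
    rewrite le_eqVlt /Defs.point /node; apply/orP; left; apply/eqP.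
    rewrite -!cat_cons !nth_cat /= !ltnS kp.
    by rewrite (leq_trans (leqnSn k) kp).
  have [j kj] : exists j, k = (size p + j)%N.
    by exists (k - size p)%N; rewrite subnKC.
  have jq : (j < size q)%N by move: kpq; rewrite kj ltn_add2l.
  apply: lt_le_trans mm1; apply: le_lt_trans (qm _ jq).
  rewrite le_eqVlt; apply/orP; left; apply/eqP.
  have nodeE i : Defs.point (p ++ q) (size p + i) = node s q i.
    rewrite /Defs.point /node; case: i => [|i].
      by rewrite addn0 -cat_cons nth_cat /= ltnS leqnn -lp (last_nth 0).
    by rewrite addnS /= nth_cat ltnNge leq_addr /= addKn.
  by rewrite kj -addnS !nodeE.
have PA2 : (P A2 <= e%:E)%E.
  by apply: cQ'm => // k kp; apply: lt_le_trans mm2; exact: pm.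
pose A := A1 `|` A2 `|` A3.
have mAA : measurable A.
  by apply: measurableU => //; apply: measurableU; exact: mA.
have PA : (P A <= (3 * e)%:E)%E.
  apply: le_trans (measureU2 _ _ _) _ => //.
    by apply: measurableU; exact: mA.
  rewrite (_ : 3 * e = (e + e) + e); last by ring.
  rewrite EFinD leeD//; apply: le_trans (measureU2 _ _ _) _; [exact: mA|exact: mA|].
  by rewrite EFinD leeD.
pose V w := \sum_(k < size q) increment Y (node s q k) (node s q k.+1) w ^+ 2.
have mV : measurable_fun setT V.
  by apply: measurable_sum => k; apply: measurable_funX; exact: measurable_increment.
have V0 w : 0 <= V w by apply: sumr_ge0 => k _; exact: sqr_ge0.
have L0 : 0 <= t - s by rewrite subr_ge0.
have pointwise w : Num.min ((Q w - Q' w) ^+ 2) M <=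
    18 * (t - s) * V w + (8 * e ^+ 2 + M * \1_A w).
  rewrite ge_min indicE; have [Aw|Aw] := pselect (A w).
    apply/orP; right; rewrite mem_set// mulr1 addrA lerDr addr_ge0//.
      by rewrite !mulr_ge0.
    by rewrite mulr_ge0// sqr_ge0.
  apply/orP; left; rewrite memNset// mulr0 addr0.
  have h1 : `|Rs (p ++ q) 0 w - Q w| < e.
    by rewrite ltNge; apply/negP => h; apply: Aw; left; left.
  have h2 : `|Rs p 0 w - Q' w| < e.
    by rewrite ltNge; apply/negP => h; apply: Aw; left; right.
  have /qv h3 : ~ A3 w by move=> h; apply: Aw; right.
  have R2 : Rs q s w ^+ 2 <= V w * (9 * (t - s)).
    by apply: le_trans (cauchy_schwarz_sum _ _) _; apply: ler_wpM2l h3; exact: (V0 w).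
  have : (Q w - Q' w - Rs q s w) ^+ 2 <= (2 * e) ^+ 2.
    rewrite -(real_normK (num_real _)) lerXn2r ?nnegrE ?mulr_ge0 ?(ltW e0)//.
    have -> : Q w - Q' w - Rs q s w =
        (Rs p 0 w - Q' w) - (Rs (p ++ q) 0 w - Q w) by rewrite Rcat; ring.
    by rewrite (le_trans (ler_normB _ _))// mulr_natl mulr2n lerD// ltW.
  have := sqr_ge0 (Q w - Q' w - Rs q s w - Rs q s w).
  move: R2; set x := Q w - Q' w; set y := Rs q s w; move=> R2 h4 h5.
  have -> : x ^+ 2 = 2 * y ^+ 2 + 2 * (x - y) ^+ 2 - (x - y - y) ^+ 2 by ring.
  by move: h5 R2 h4; rewrite exprMn; nra.
have V2 : (\int[P]_w (V w)%:E <= (K * (t - s))%:E)%E.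
  under eq_integral do rewrite /V -sumEFin.
  rewrite ge0_integral_sum//; last 2 first.
  - by move=> k; apply: measurable_sqr_EFin; exact: measurable_increment.
  - by move=> k w _; rewrite lee_fin sqr_ge0.
  have -> : K * (t - s) = \sum_(k < size q) K * (node s q k.+1 - node s q k).
    by rewrite -mulr_sumr (sum_node idfun qt).
  rewrite -sumEFin; apply: lee_sum => k _.
  have kq := ltn_ord k; apply: YK.
  - exact: (node_le qt (leq0n k) (ltnW kq)).
  - exact/ltW/(node_lt qt).
  - exact: node_leb qt kq.
apply: (@le_trans _ _ (\int[P]_w (18 * (t - s) * V w +
    (8 * e ^+ 2 + M * \1_A w))%R%:E)%E).
  apply: ge0_le_integral => //.
  - by move=> w _; rewrite lee_fin le_min sqr_ge0 ltW.
  - apply/measurable_EFinP; apply: measurable_minr => //.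
    exact: measurable_funX.
  - apply/measurable_EFinP; apply: measurable_funD.
      by apply: measurable_funM => //; exact: measurable_cst.
    apply: measurable_funD; first exact: measurable_cst.
    by apply: measurable_funM; [exact: measurable_cst|exact: measurable_indic].
  - by move=> w _; rewrite lee_fin.
rewrite [X in (X <= _)%E](_ : _ = \int[P]_w ((18 * (t - s))%:E * (V w)%:E +
    ((8 * e ^+ 2)%:E + M%:E * (\1_A w)%:E)))%E; last first.
  by apply: eq_integral => w _; rewrite -!EFinM -!EFinD.
have mI : measurable_fun setT (fun w => (\1_A w)%:E : \bar R).
  by apply/measurable_EFinP; exact: measurable_indic.
have mVE : measurable_fun setT (fun w => (V w)%:E) by exact/measurable_EFinP.
have c0 : (0 <= (8 * e ^+ 2)%:E)%E by rewrite lee_fin mulr_ge0// sqr_ge0.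
rewrite ge0_integralD//; last 4 first.
- by move=> w _; rewrite mule_ge0// lee_fin// mulr_ge0.
- exact: measurable_funeM.
- by move=> w _; rewrite adde_ge0// mule_ge0// lee_fin// ltW.
- by apply: emeasurable_funD => //; exact: measurable_funeM.
rewrite ge0_integralZl//; last 2 first.
- by move=> w _; rewrite lee_fin.
- by rewrite lee_fin mulr_ge0.
rewrite ge0_integralD//; last 2 first.
- by move=> w _; rewrite mule_ge0// lee_fin// ltW.
- exact: measurable_funeM.
rewrite ge0_integralZl//; last by rewrite lee_fin ltW.
rewrite -[X in (_ + (X + _) <= _)%E]/(\int[P]_w (cst (8 * e ^+ 2)%:E) w)%E.
rewrite integral_cst// [X in (_ + (_ * X + _) <= _)%E]probability_setT mule1.
rewrite integral_indic// setIT.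
apply: (@le_trans _ _ ((18 * (t - s))%:E * (K * (t - s))%:E +
    ((8 * e ^+ 2)%:E + M%:E * (3 * e)%:E))%E).
  rewrite leeD// ?lee_wpmul2l// ?lee_fin ?mulr_ge0//.
  by rewrite leeD2l// lee_wpmul2l// lee_fin ltW.
rewrite -!(EFinM, EFinD) lee_fin.
have -> : 18 * (t - s) * (K * (t - s)) = 18 * (K * (t - s) ^+ 2) by ring.
by rewrite lerD2l; move: ea; lra.
Qed.

Lemma quadratic_covariation0 (Y : R -> {RV P >-> R}) :
  quadratic_covariation B Y 0 (cst 0).
Proof.
move=> e h e0 h0; exists 1 => // p /itv_partitionxx -> _.
rewrite [X in P X](_ : _ = set0) ?measure0 ?lee_fin ?(ltW h0)//.
apply/seteqP; split => // w /=; rewrite big_ord0 subrr normr0.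
by rewrite leNgt e0.
Qed.

End covariation.

(** * Moments of iterated integrals *)

Section iterated.
Context d (T : measurableType d) (R : realType) (P : probability T R).
Variable B : R -> {RV P >-> R}.
Hypothesis bB : brownian_motion B.

(** The assumption [K * (t - s) <= M] makes the covariation term, of order
    K (t - s)^2, comparable with the Ito term, of order M (t - s). The constant
    is 73 = 2 (32 + 18 / 4), where 1 / 4 is the square of the Stratonovich factor. *)
Lemma msq_stochastic_increment sense (Y : R -> {RV P >-> R}) s t M K
    (J J' : {RV P >-> R}) : 0 <= s <= t -> 0 <= K -> K * (t - s) <= M ->
  {ae P, forall w, {within `[0, +oo[, continuous (fun t => Y t w)}} ->
  (forall u, 0 <= u <= t -> (msq P (Y u) <= M%:E)%E) ->
  (forall u v, 0 <= u -> u <= v -> v <= t ->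
     (msq P (increment Y u v) <= (K * (v - u))%:E)%E) ->
  stochastic_integral sense B Y t J -> stochastic_integral sense B Y s J' ->
  (msq P (fun w => (J w - J' w)%R) <= (73 * (M * (t - s)))%:E)%E.
Proof.
move=> /[dup] st /andP[s0 st'] K0 KM cY YM YK.
have ts0 : 0 <= t - s by rewrite subr_ge0.
have M0 : 0 <= M.
  by rewrite -lee_fin (le_trans (msq_ge0 P (Y t)))// YM// lexx (le_trans s0).
case: sense => [Jt Js|] /=.
  apply: (le_trans (msq_ito_increment bB cY st YM Jt Js)).
  by rewrite lee_fin ler_wpM2r ?mulr_ge0// ler_nat.
move=> [I [Q [It Qt JIQ]]] [I' [Q' [Is Qs JIQ']]].
have mIQ : measurable_fun setT (fun w => I w - I' w) by exact: measurable_funB.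
have mQ : measurable_fun setT (fun w => Q w - Q' w) by exact: measurable_funB.
have mQ2 : measurable_fun setT (fun w => 2^-1 * (Q w - Q' w)).
  by apply: measurable_funM => //; exact: measurable_cst.
rewrite (@ae_eq_msq _ _ _ P _ (fun w => (I w - I' w) + 2^-1 * (Q w - Q' w)));
  last 3 first.
- exact: measurable_funB.
- exact: measurable_funD.
- by apply: filterS2 JIQ JIQ' => w -> ->; field.
apply: (le_trans (msqD_le _ mIQ mQ2)); rewrite msqZ//.
have YKs u v : s <= u -> u <= v -> v <= t ->
    (msq P (increment Y u v) <= (K * (v - u))%:E)%E.
  by move=> su; apply: YK; exact: le_trans su.
apply: (@le_trans _ _ (2%:E * ((32 * (M * (t - s)))%:E +
    (2^-1 ^+ 2)%:E * (18 * (K * (t - s) ^+ 2))%:E))%E).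
  rewrite lee_wpmul2l// leeD//; first exact: (msq_ito_increment bB cY st YM It Is).
  rewrite lee_wpmul2l ?lee_fin ?sqr_ge0//.
  exact: (msq_covariation_increment bB st K0 YKs Qt Qs).
rewrite -!(EFinM, EFinD) lee_fin.
have : K * (t - s) ^+ 2 <= M * (t - s) by rewrite expr2 mulrA ler_wpM2r.
set x := K * _; set y := M * _; lra.
Qed.

Lemma stochastic_integral0 sense (Y : R -> {RV P >-> R}) :
  stochastic_integral sense B Y 0 (cst 0).
Proof.
case: sense; first exact: ito_integral0.
exists (cst 0), (cst 0); split; first exact: ito_integral0.
  exact: quadratic_covariation0.
by apply/nearW => w /=; rewrite mul0r addr0.
Qed.

(** The scaling exponent of an iterated integral: by Brownian scaling [B]
    counts for the square root of time. *)
Definition weight (I : seq 'I_2) : nat :=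
  \sum_(i <- I) (if i == 0%R then 2 else 1)%N.

Lemma weight_rcons I i :
  weight (rcons I i) = (weight I + if i == 0%R then 2 else 1)%N.
Proof. by rewrite /weight -cats1 big_cat /= big_seq1. Qed.

Lemma ord2P (i : 'I_2) : i = 0 \/ i = 1.
Proof. by case: i => [[|[|//]] lti]; [left|right]; apply: val_inj. Qed.

(** Induction on the outermost integrator. Times are compared with a fixed horizon [h],
    so that all bounds are monomials in [h]; an increment over [s, t] trades one factor
    [h] for [t - s]. *)
Lemma msq_iterated_integral sense (X : seq 'I_2 -> R -> {RV P >-> R}) (h : R) :
  iterated_integrals sense B X -> 0 < h ->
  forall I s t, 0 <= s -> s <= t -> t <= h ->
  (msq P (X I t) <= (73 ^+ size I * h ^+ weight I)%:E)%E /\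
  (msq P (increment (X I) s t) <=
     (73 ^+ size I * h ^+ weight I / h * (t - s))%:E)%E.
Proof.
move=> [X0 cX Xtime Xstoch] h0; elim/last_ind => [|I i ih] s t s0 st th.
  have t0 := le_trans s0 st.
  rewrite /weight big_nil !expr0 mulr1; split.
    rewrite (_ : (X [::] t : T -> R) = cst 1) ?msq_cst ?expr1n//.
    by apply/funext => w; exact: X0.
  rewrite (_ : increment (X [::]) s t = cst 0); last first.
    by apply/funext => w; rewrite /increment !X0// subrr.
  by rewrite msq_cst expr0n lee_fin mulr_ge0 ?subr_ge0// divr_ge0// ltW.
set M := 73 ^+ size I * h ^+ weight I in ih *.
have M0 : 0 < M by rewrite mulr_gt0// exprn_gt0.
have XM u : 0 <= u <= h -> (msq P (X I u) <= M%:E)%E.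
  by move=> /andP[u0 uh]; have [] := ih u u u0 (lexx u) uh.
have XK u v : 0 <= u -> u <= v -> v <= h ->
    (msq P (increment (X I) u v) <= (M / h * (v - u))%:E)%E.
  by move=> u0 uv vh; have [] := ih u v u0 uv vh.
have MS : 73 ^+ size (rcons I i) * h ^+ weight (rcons I i) =
    73 * M * h ^+ (if i == 0%R then 2 else 1)%N.
  by rewrite size_rcons weight_rcons exprS exprD /M !mulrA.
rewrite {}MS.
have h_neq0 := lt0r_neq0 h0.
have ts0 : 0 <= t - s by rewrite subr_ge0.
have tsh : t - s <= h by rewrite lerBlDr (le_trans th)// lerDl.
have t0 := le_trans s0 st.
have [->|->] := ord2P i; rewrite ?eqxx /=.
- have Xt0 (J : {RV P >-> R}) u : 0 <= u -> u <= t ->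
      {ae P, forall w, J w = \int[lebesgue_measure]_(v in `[0, u]) X I v w} ->
      (msq P (fun w => (X (rcons I 0) t w - J w)%R) <= ((t - u) ^+ 2 * M)%:E)%E.
    move=> u0 ut Ju; apply: (msq_time_integral (cX I) _ _ (Xtime I t t0) Ju).
      by rewrite u0.
    by move=> v /andP[uv vt]; apply: XM; rewrite (le_trans u0 uv) (le_trans vt).
  split.
    (* The increment from time 0, where the integral vanishes. *)
    have := Xt0 (cst 0) 0 (lexx 0) t0.
    under [X in msq P X]eq_fun do rewrite subr0.
    rewrite subr0 => /(_ _)/le_trans; apply.
      by apply/nearW => w; rewrite set_itv1 Rintegral_set1.
    rewrite lee_fin [leRHS]mulrC; apply: ler_pM.
    + exact: sqr_ge0.
    + exact: ltW.
    + by rewrite lerXn2r// nnegrE ltW.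
    + by rewrite ler_peMl ?ler1n// ltW.
  apply: (le_trans (Xt0 _ s s0 st (Xtime I s s0))).
  rewrite lee_fin (_ : 73 * M * h ^+ 2 / h * (t - s) = (t - s) * (h * (73 * M))); last by field.
  rewrite expr2 -mulrA ler_wpM2l//; apply: ler_pM => //; first exact: ltW.
  by rewrite ler_peMl ?ler1n// ltW.
- have K0 : 0 <= M / h by rewrite divr_ge0// ltW.
  have Xt0 (J : {RV P >-> R}) u : 0 <= u -> u <= t ->
      stochastic_integral sense B (X I) u J ->
      (msq P (fun w => (X (rcons I 1) t w - J w)%R) <= (73 * (M * (t - u)))%:E)%E.
    move=> u0 ut Ju.
    apply: (@msq_stochastic_increment sense (X I) u t M (M / h) _ _ _ K0 _ (cX I)
      _ _ (Xstoch I t t0) Ju).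
    + by rewrite u0.
    + rewrite mulrAC ler_pdivrMr//; apply: ler_wpM2l; first exact: ltW.
      by rewrite lerBlDr (le_trans th)// lerDl.
    + by move=> v /andP[v0 vt]; apply: XM; rewrite v0 (le_trans vt).
    + by move=> v x v0 vx xt; apply: XK => //; exact: le_trans th.
  split.
    have := Xt0 (cst 0) 0 (lexx 0) t0 (stochastic_integral0 sense (X I)).
    under [X in msq P X]eq_fun do rewrite subr0.
    move/le_trans; apply.
    by rewrite lee_fin subr0 expr1 mulrA ler_wpM2l// mulr_ge0// ltW.
  apply: (le_trans (Xt0 _ s s0 st (Xstoch I s s0))).
  by rewrite lee_fin le_eqVlt; apply/orP; left; apply/eqP; field.
Qed.

End iterated.

(** * Iterated vector fields *)

Section vector_fields.

Lemma derive1_scaled_power (K : numFieldType) (c z : K) (n : nat) : z != 0 ->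
  derive1 (fun y : K => c * (y / y ^+ n) : K^o) z =
  (1 - n%:R) * c * (z / z ^+ n.+1).
Proof.
move=> z0; rewrite -[LHS]/(derive1 (fun y : K => c * (y / y ^+ n)) z).
 have zn0 : z ^+ n != 0 by rewrite expf_neq0.
pose pw := (id : K -> K) ^+ n.
have pwE : pw = fun y => y ^+ n by apply/funext => y; rewrite /pw fctE.
have dpw : is_derive z 1 pw ((n%:R * z ^+ n.-1) *: 1) by exact: is_deriveX.
have dpwv : derivable (fun y => (pw y)^-1) z 1.
  by apply: derivableV; rewrite ?pwE//; rewrite -pwE; exact: ex_derive.
have vpw : 'D_1 (fun y => (pw y)^-1) z = - (z ^+ n) ^- 2 * (n%:R * z ^+ n.-1).
  rewrite deriveV ?derive_val ?pwE//; last by rewrite -pwE; exact: ex_derive.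
  by rewrite /GRing.scale/= mulr1.
have -> : (fun y : K => c * (y / y ^+ n)) = c \*o (id * (fun y => (pw y)^-1)).
  by apply/funext => y; rewrite /= fctE pwE.
rewrite derive1E deriveMl; last exact: derivableM.
rewrite deriveM// vpw derive_id pwE /GRing.scale/= mulr1.
case: n zn0 {pw pwE dpw dpwv vpw} => [_|n zn0].
  by rewrite mul0r mulr0 mulr0 add0r subr0 !expr1 expr0 mul1r divff// mulr1 invr1 mulr1.
rewrite [n.+1.-1]/= -natr1 !exprS; rewrite exprS in zn0.
have zn : z ^+ n != 0 by rewrite expf_neq0.
by rewrite expr0 mulr1; field; rewrite z0 zn.
Qed.


Context (R : realType).
Local Open Scope complex_scope.

(** Both fields map a multiple of a power of z to such a multiple, lowering the degree
    by one for d/dz and by two for (1/z) d/dz. The derivative only depends on the function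
    near z, so the formula away from 0 propagates. *)
Lemma V_Id_power (kappa : R) (I : seq 'I_2) :
  exists c : R[i], forall z, z != 0 -> V_Id kappa I z = c * (z / z ^+ weight I).
Proof.
elim: I => [|i I [c cI]].
  by exists 1 => z z0; rewrite /weight big_nil expr0 divr1 mul1r.
have dI z : z != 0 -> complex_derive (V_Id kappa I) z =
    (1 - (weight I)%:R) * c * (z / z ^+ (weight I).+1).
  move=> z0; rewrite -(derive1_scaled_power c (weight I) z0).
  rewrite /complex_derive !derive1E. apply: (@near_eq_derive R[i] _ R[i]^o).
  have : \forall y \near (z : R[i]^o), y != 0.
    have := @cvgr_neq0 _ R[i]^o (R[i]^o) (nbhs (z : R[i]^o)) _ id z.
    by apply => //; exact: cvg_id.
  by apply: filterS => y /= y0; rewrite cI.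
have wE : weight (i :: I) = ((if i == 0%R then 2 else 1) + weight I)%N.
  by rewrite /weight big_cons.
have [i0|i1] := ord2P i.
  exists ((- 2 / kappa)%:C * ((1 - (weight I)%:R) * c)) => z z0.
  rewrite wE /V_Id /= -/(V_Id kappa I) /V i0 eqxx dI// add2n !exprS.
  have zn : z ^+ weight I != 0 by rewrite expf_neq0.
  by move: (- 2 / kappa)%:C => k; field; rewrite z0 zn.
exists ((1 - (weight I)%:R) * c) => z z0.
by rewrite wE /V_Id /= -/(V_Id kappa I) /V i1 dI.
Qed.

End vector_fields.

(** * The backward Loewner flow *)

Section loewner.
Context (R : realType).
Local Notation mu := (@lebesgue_measure R).
Local Notation normc := (@ComplexField.Normc.normc R).
Import HBNNSimple.

(** The drift is a function of time of which no measurability is known, so the bound is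
    read off the definition of the integral as a supremum over simple functions. *)
Lemma ge0_integral_itv_bound (f : R -> \bar R) (t M : R) : 0 <= t -> 0 <= M ->
  (forall u, 0 <= u <= t -> (0 <= f u <= M%:E)%E) ->
  (\int[mu]_(u in `[0%R, t]) f u <= (M * t)%:E)%E.
Proof.
move=> t0 M0 fM.
have f0 u : `[0, t]%classic u -> (0 <= f u)%E.
  by rewrite /= in_itv/= => /fM/andP[].
have mut : mu `[0, t] = t%:E.
  rewrite lebesgue_measure_itv/= lte_fin; case: ltP => h; first by rewrite sube0.
  by congr EFin; apply/eqP; rewrite eq_le t0 h.
rewrite ge0_integralE//; apply: ge_ereal_sup => _ [h /= hf <-].
have mI : measurable (`[0, t]%classic : set (measurableTypeR R)) by exact: measurable_itv.
rewrite -integralT_nnsfun.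
apply: (@le_trans _ _ (\int[mu]_(u in `[0%R, t]) (cst M%:E) u)%E); last first.
  by rewrite integral_cst// [X in (_ * X <= _)%E]mut -EFinM.
rewrite [leRHS]integral_mkcond; apply: ge0_le_integral => //.
- by move=> u _; rewrite lee_fin.
- exact/measurable_EFinP.
- by apply/(measurable_restrictT _ _).1 => //; exact: measurable_cst.
- move=> u _; apply: (le_trans (hf u)); rewrite !patchE; case: ifPn => //.
  by rewrite inE/= in_itv/= => /fM/andP[].
Qed.

Lemma Rintegral_itv_bound (f : R -> R) (t M : R) : 0 <= t -> 0 <= M ->
  (forall u, 0 <= u <= t -> `|f u| <= M) ->
  `|\int[mu]_(u in `[0, t]) f u| <= M * t.
Proof.
move=> t0 M0 fM; rewrite /Rintegral integralE.
have pos0 : (0 <= \int[mu]_(u in `[0%R, t]) (EFin \o f)^\+ u)%E.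
  by apply: integral_ge0 => u _; exact: funepos_ge0.
have neg0 : (0 <= \int[mu]_(u in `[0%R, t]) (EFin \o f)^\- u)%E.
  by apply: integral_ge0 => u _; exact: funeneg_ge0.
have : (\int[mu]_(u in `[0%R, t]) (EFin \o f)^\+ u <= (M * t)%:E)%E.
  apply: ge0_integral_itv_bound => // u /fM; rewrite ler_norml => /andP[_ h].
  by rewrite funepos_ge0/= funeposE/= -EFin_max lee_fin ge_max h.
have : (\int[mu]_(u in `[0%R, t]) (EFin \o f)^\- u <= (M * t)%:E)%E.
  apply: ge0_integral_itv_bound => // u /fM; rewrite ler_norml => /andP[h _].
  by rewrite funeneg_ge0/= funenegE/= -EFin_max lee_fin ge_max lerNl h.
move: pos0 neg0; case: (integral _ _ _) => [x| |]//; case: (integral _ _ _) => [y| |]//.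
rewrite -EFinB /= !lee_fin => x0 y0 yM xM.
by rewrite ler_norml; apply/andP; split; lra.
Qed.

Lemma normc_le_ReIm (z : R[i]) : normc z <= `|complex.Re z| + `|complex.Im z|.
Proof.
case: z => a b /=; rewrite -[leRHS]ger0_norm ?addr_ge0// -sqrtr_sqr.
rewrite ler_wsqrtr// sqrrD !real_normK ?num_real// lerD2r lerDl.
by rewrite mulrn_wge0// mulr_ge0.
Qed.

(** As [eps <= b], both |a| eps and b eps are at most a^2 + b^2. The sign of the
    imaginary part is what drives the flow away from the singularity. *)
Lemma ReIm_inverse (k a b eps : R) : 0 < k -> 0 < eps -> eps <= b ->
  [/\ `|complex.Re ((- k)%:C / (a +i* b))| <= k / eps,
      0 <= complex.Im ((- k)%:C / (a +i* b)) &
      `|complex.Im ((- k)%:C / (a +i* b))| <= k / eps].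
Proof.
move=> k0 eps0 epsb; have b0 := lt_le_trans eps0 epsb.
have n0 : 0 < a ^+ 2 + b ^+ 2 by rewrite ltr_wpDl ?sqr_ge0// exprn_gt0.
have -> : complex.Re ((- k)%:C / (a +i* b)) = - (k * (a / (a ^+ 2 + b ^+ 2))).
  by rewrite /=; ring.
have -> : complex.Im ((- k)%:C / (a +i* b)) = k * (b / (a ^+ 2 + b ^+ 2)).
  by rewrite /=; ring.
have bn0 : 0 <= k * (b / (a ^+ 2 + b ^+ 2)).
  by rewrite mulr_ge0 ?ltW// divr_gt0.
split => //.
- rewrite normrN normrM (ger0_norm (ltW k0)) ler_wpM2l ?(ltW k0)//.
  rewrite normrM normfV (gtr0_norm n0) ler_pdivrMr// ler_pdivlMl//.
  have : `|a| ^+ 2 = a ^+ 2 by rewrite real_normK ?num_real.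
  have := normr_ge0 a; set x := `|a|; move=> x0 <-.
  have h1 : eps * x <= b * x by rewrite ler_wpM2r.
  have h2 : 0 <= b * x by rewrite mulr_ge0// ltW.
  by have := sqr_ge0 (x - b); rewrite sqrrB -mulr_natl; lra.
- rewrite ger0_norm// ler_wpM2l ?(ltW k0)// ler_pdivrMr// ler_pdivlMl//.
  have h1 : eps * b <= b ^+ 2 by rewrite expr2 ler_wpM2r// ltW.
  by have := sqr_ge0 a; lra.
Qed.

(** The imaginary part of the flow is nondecreasing, hence at least [eps], which keeps
    the flow away from the singularity of the drift. *)
Lemma loewner_drift (kappa eps t : R) (Z : R -> R[i]) (b : R -> R) :
  0 < kappa -> 0 < eps -> 0 <= t ->
  (forall u, 0 <= u -> 0 < complex.Im (Z u)) ->
  (forall u, 0 <= u -> Z u = (0 +i* eps) +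
     complex_integral `[0, u] (fun s => (- 2 / kappa)%:C / Z s) + (b u)%:C) ->
  normc (Z t - (0 +i* eps) - (b t)%:C) <= 4 / kappa / eps * t.
Proof.
move=> kappa0 eps0 t0 ImZ ZE.
have k0 : 0 < 2 / kappa by rewrite divr_gt0.
have kE : - 2 / kappa = - (2 / kappa) by rewrite mulNr.
have Imge u : 0 <= u -> eps <= complex.Im (Z u).
  move=> u0; rewrite ZE// /complex_integral /= addr0 lerDl.
  apply: Rintegral_ge0 => s; rewrite /= in_itv/= => /andP[s0 _].
  move: (ImZ s s0); rewrite kE; case: (Z s) => x y /= y0.
  by have [_ + _] := @ReIm_inverse (2 / kappa) x y y k0 y0 (lexx _).
have bound s : 0 <= s -> 
    `|complex.Re ((- 2 / kappa)%:C / Z s)| <= 2 / kappa / eps /\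
    `|complex.Im ((- 2 / kappa)%:C / Z s)| <= 2 / kappa / eps.
  move=> /Imge; rewrite kE; case: (Z s) => x y epsy.
  by have [] := @ReIm_inverse (2 / kappa) x y eps k0 eps0 epsy.
have ke0 : 0 <= 2 / kappa / eps by rewrite divr_ge0// ltW.
rewrite ZE//; set D := complex_integral _ _.
rewrite (_ : _ + D + _ - _ - _ = D); last by ring.
rewrite /D.
apply: (le_trans (normc_le_ReIm _)).
rewrite /complex_integral /= (_ : 4 / kappa / eps * t =
  2 / kappa / eps * t + 2 / kappa / eps * t); last by ring.
by apply: lerD; apply: Rintegral_itv_bound => // u /andP[/bound[]].
Qed.

End loewner.

(** * Norms of complex random variables *)

Section complex_measurability.
Context d (T : measurableType d) (R : realType).
Local Notation normc := (@ComplexField.Normc.normc R).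
Implicit Types F : T -> R[i].

(** Componentwise, as in the measurability clause of [backward_loewner]. *)
Definition cmeasurable F :=
  measurable_fun setT (fun w => complex.Re (F w)) /\
  measurable_fun setT (fun w => complex.Im (F w)).

Lemma cmeasurableB F F' : cmeasurable F -> cmeasurable F' ->
  cmeasurable (fun w => F w - F' w).
Proof.
move=> [rF iF] [rF' iF']; split.
  rewrite (_ : (fun _ => _) = (fun w => complex.Re (F w) - complex.Re (F' w))).
    exact: measurable_funB.
  by apply/funext => w; case: (F w) (F' w) => [a b] [a' b'].
rewrite (_ : (fun _ => _) = (fun w => complex.Im (F w) - complex.Im (F' w))).
  exact: measurable_funB.
by apply/funext => w; case: (F w) (F' w) => [a b] [a' b'].
Qed.

Lemma cmeasurable_sum (I : Type) (r : seq I) (F : I -> T -> R[i]) :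
  (forall i, cmeasurable (F i)) -> cmeasurable (fun w => \sum_(i <- r) F i w).
Proof.
move=> mF; split.
  rewrite (_ : (fun _ => _) = (fun w => \sum_(i <- r) complex.Re (F i w))).
    by apply: measurable_sum => i; have [] := mF i.
  apply/funext => w; elim: r => [|i r ih]; first by rewrite !big_nil.
  by rewrite !big_cons -ih; case: (F i w) (\sum_(j <- r) _) => [a b] [a' b'].
rewrite (_ : (fun _ => _) = (fun w => \sum_(i <- r) complex.Im (F i w))).
  by apply: measurable_sum => i; have [] := mF i.
apply/funext => w; elim: r => [|i r ih]; first by rewrite !big_nil.
by rewrite !big_cons -ih; case: (F i w) (\sum_(j <- r) _) => [a b] [a' b'].
Qed.

Lemma cmeasurableZ (v : R[i]) (X : T -> R) : measurable_fun setT X ->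
  cmeasurable (fun w => v * (X w)%:C).
Proof.
case: v => a b mX; split.
  rewrite (_ : (fun _ => _) = (fun w => a * X w)).
    by apply: measurable_funM => //; exact: measurable_cst.
  by apply/funext => w /=; rewrite mulr0 subr0.
rewrite (_ : (fun _ => _) = (fun w => b * X w)).
  by apply: measurable_funM => //; exact: measurable_cst.
by apply/funext => w /=; rewrite mulr0 add0r.
Qed.

Lemma measurable_normc F : cmeasurable F ->
  measurable_fun setT (fun w => normc (F w)).
Proof.
move=> [rF iF].
rewrite (_ : (fun _ => _) = (fun w => Num.sqrt
    (complex.Re (F w) ^+ 2 + complex.Im (F w) ^+ 2))).
  apply: (measurableT_comp (f := @Num.sqrt R)).
    by apply: continuous_measurable_fun; exact: sqrt_continuous.
  by apply: measurable_funD; exact: measurable_funX.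
by apply/funext => w; case: (F w).
Qed.

Lemma normc_sum (I : Type) (r : seq I) (z : I -> R[i]) :
  normc (\sum_(i <- r) z i) <= \sum_(i <- r) normc (z i).
Proof.
elim: r => [|i r ih]; first by rewrite !big_nil ComplexField.Normc.normc0.
by rewrite !big_cons (le_trans (@le_normcD R _ _))// lerD2l.
Qed.

Lemma normc_real (x : R) : normc x%:C = `|x|.
Proof. by rewrite /= expr0n/= addr0 sqrtr_sqr. Qed.

Lemma normcX (z : R[i]) n : normc (z ^+ n) = normc z ^+ n.
Proof.
elim: n => [|n ih]; first by rewrite !expr0 ComplexField.Normc.normc1.
by rewrite !exprS ComplexField.Normc.normcM ih.
Qed.

End complex_measurability.

Section bounds.
Context d (T : measurableType d) (R : realType) (P : probability T R).
Local Notation normc := (@ComplexField.Normc.normc R).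

Lemma msq_sum_bound (I : finType) (U : I -> T -> R) (c : I -> R) (e : R) :
  (forall i, measurable_fun setT (U i)) ->
  (forall i, (msq P (U i) <= (c i * e)%:E)%E) ->
  (msq P (fun w => (\sum_i U i w)%R) <=
   ((size (index_enum I))%:R * (\sum_i c i) * e)%:E)%E.
Proof.
move=> mU Uc; apply: (le_trans (msq_sum_le _ _ mU)).
rewrite -mulrA mulr_suml EFinM lee_wpmul2l ?lee_fin//.
by rewrite -sumEFin; exact: lee_sum.
Qed.

Lemma msq_norm (U : T -> R) : msq P (fun w => `|U w|%R) = msq P U.
Proof. by apply: eq_integral => w _; rewrite real_normK ?num_real. Qed.

Lemma L2norm_le (Y : T -> R[i]) (G : T -> R) (c : R) : cmeasurable Y ->
  measurable_fun setT G -> 0 <= c ->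
  {ae P, forall w, normc (Y w) <= G w} -> (msq P G <= (c ^+ 2)%:E)%E ->
  (L2norm P Y <= c%:E)%E.
Proof.
move=> mY mG c0 YG Gc.
have mN := measurable_normc mY.
have N0 z : 0 <= normc z by case: z => a b; exact: sqrtr_ge0.
have NG : (msq P (fun w => normc (Y w)) <= (c ^+ 2)%:E)%E.
  apply: le_trans Gc; apply: ae_le_msq => //.
  by apply: filterS YG => w h; rewrite lerXn2r ?nnegrE ?N0// (le_trans _ h).
rewrite /L2norm unlock.
rewrite (_ : (\int[P]_w _)%E = msq P (fun w => normc (Y w))); last first.
  apply: eq_integral => w _; rewrite gee0_abs ?lee_fin// poweR_EFin.
  by rewrite -powR_mulrn.
move: NG (msq_ge0 P (fun w => normc (Y w))); case: (msq _ _) => [x| |]//.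
rewrite poweR_EFin !lee_fin => xc x0; rewrite powR12_sqrt//.
by rewrite -(ger0_norm c0) -sqrtr_sqr ler_wsqrtr.
Qed.

End bounds.

(** * The one-step estimate *)

Section taylor_terms.
Context (R : realType).
Local Notation normc := (@ComplexField.Normc.normc R).

Lemma taylor_split (kappa : R) (r : nat) (z : R[i]) (x : seq 'I_2 -> R) :
  x [::] = 1 ->
  taylor kappa r z x = z + \sum_(k < r) \sum_(I : k.+1.-tuple 'I_2)
    V_Id kappa I z * (x I)%:C.
Proof.
move=> x0; rewrite /taylor big_ord_recl; congr (_ + _).
rewrite (bigD1 [tuple])//= big1 ?addr0; last first.
  by move=> I /negP[]; apply/eqP/tuple0.
by rewrite x0 mulr1.
Qed.

(** The blow-up of the vector fields at distance [eps] from the singularity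
    cancels the smallness of the iterated integrals up to one factor [eps]. *)
Lemma normc_V_Id (kappa eps : R) (I : seq 'I_2) (c : R[i]) : 0 < eps ->
  (forall z, z != 0 -> V_Id kappa I z = c * (z / z ^+ weight I)) ->
  normc (V_Id kappa I (0 +i* eps)) ^+ 2 * (eps ^+ 2) ^+ weight I =
  normc c ^+ 2 * eps ^+ 2.
Proof.
move=> eps0 cI; have ne : normc (0 +i* eps) = eps.
  by rewrite /= expr0n add0r sqrtr_sqr gtr0_norm.
have z0 : 0 +i* eps != 0 :> R[i].
  apply/negP => /eqP h; move: ne; rewrite h ComplexField.Normc.normc0 => e.
  by rewrite -e ltxx in eps0.
rewrite cI// !ComplexField.Normc.normcM ComplexField.Normc.normcV normcX ne.
have e_neq0 := lt0r_neq0 eps0; have en0 : eps ^+ weight I != 0 by rewrite expf_neq0.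
by rewrite -exprM mulnC exprM; field.
Qed.

End taylor_terms.

Close Scope classical_set_scope.
Unset Implicit Arguments.
Set Strict Implicit.
Set Printing Implicit Defensive.

Local Open Scope complex_scope.

Theorem theorem5p2 (R : realType) (kappa : R) (r : nat)
    (kappa_gt0 : 0 < kappa) (r_ge1 : (1 <= r)%N) :
  exists C eps0 : R, 0 < eps0 /\
    forall (d : measure_display) (T : measurableType d) (P : probability T R)
      (B : R -> {RV P >-> R}), brownian_motion B ->
    forall (sense : integral_sense) (X : seq 'I_2 -> R -> {RV P >-> R}),
      iterated_integrals sense B X ->
    forall eps : R, 0 < eps < eps0 ->
    forall Z : R -> T -> R[i], backward_loewner kappa B (0 +i* eps) Z ->
    forall t : R, 0 <= t <= eps ^+ 2 ->
      (L2norm P (fun w =>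
         (Z t w - taylor kappa r (0 +i* eps) (fun I => X I t w))%R) <=
       (C * eps)%:E)%E.
Proof.
have /choice[c cP] := V_Id_power kappa.
pose normc := @ComplexField.Normc.normc R.
pose C1 (I : seq 'I_2) := normc (c I) ^+ 2 * 73 ^+ size I.
pose S := \sum_(k < r)
  ((size (index_enum (k.+1.-tuple 'I_2)))%:R * \sum_(I : k.+1.-tuple 'I_2) C1 I).
pose S' := (size (index_enum 'I_r))%:R * S.
(* C^2 collects the bounds on the drift, on B_t and on the terms of positive degree;
   the factors 2 come from squaring sums of two terms. *)
pose a := 4 / kappa; pose C := Num.sqrt (2 * (a ^+ 2 + 2 * (8 + S'))).
exists C, 1; split=> // d T P B bB sense X iX eps /andP[eps0 _] Z [mZ Zae] t.
move=> /andP[t0 teps].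
have C1_ge0 I : 0 <= C1 I by rewrite mulr_ge0 ?sqr_ge0// exprn_ge0.
have S_ge0 : 0 <= S.
  by apply: sumr_ge0 => k _; rewrite mulr_ge0//; apply: sumr_ge0 => I _; exact: C1_ge0.
have S'_ge0 : 0 <= S' by rewrite mulr_ge0.
pose v (I : seq 'I_2) := normc (V_Id kappa I (0 +i* eps)).
pose U (I : seq 'I_2) w := v I * `|X I t w|.
have mU I : measurable_fun setT (U I).
  apply: measurable_funM; first exact: measurable_cst.
  by apply: measurableT_comp.
have eps20 : 0 < eps ^+ 2 by rewrite exprn_gt0.
have U2 I : (msq P (U I) <= (C1 I * eps ^+ 2)%:E)%E.
  rewrite msqZ ?msq_norm; last by apply: measurableT_comp.
  have [X2 _] := msq_iterated_integral bB iX eps20 I t0 (lexx t) teps.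
  apply: (@le_trans _ _ ((v I ^+ 2)%:E * (73 ^+ size I * (eps ^+ 2) ^+ weight I)%:E)%E).
    by rewrite lee_wpmul2l// lee_fin sqr_ge0.
  rewrite -EFinM lee_fin mulrCA [v I]/v (normc_V_Id eps0 (cP I)) /C1.
  by rewrite mulrA [73 ^+ _ * _]mulrC.
pose V w := \sum_(k < r) \sum_(I : k.+1.-tuple 'I_2) U I w.
have mV : measurable_fun setT V.
  by apply: measurable_sum => k; apply: measurable_sum => I; exact: mU.
have V2 : (msq P V <= (S' * eps ^+ 2)%:E)%E.
  rewrite /S' /S; apply: (@msq_sum_bound _ T R P 'I_r
    (fun k w => \sum_(I : k.+1.-tuple 'I_2) U I w)) => k.
    by apply: measurable_sum => I; exact: mU.
  by apply: (@msq_sum_bound _ T R P (k.+1.-tuple 'I_2) (fun I => U I)) => I;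
    [exact: mU|exact: U2].
have Bt : {ae P, forall w, B t w = increment B 0 t w}.
  by case: bB => B0 _ _ _; apply: filterS B0 => w; rewrite /increment => ->; rewrite subr0.
have Bt2 : (msq P (B t) <= (8 * t)%:E)%E.
  rewrite (ae_eq_msq _ _ Bt)//; last exact: measurable_increment.
  by have := msq_increment bB (lexx 0) t0; rewrite subr0.
pose G w := a * eps + (`|B t w| + V w).
have mB : measurable_fun setT (fun w => `|B t w|) by apply: measurableT_comp.
have mBV : measurable_fun setT (fun w => `|B t w| + V w) by exact: measurable_funD.
have mG : measurable_fun setT G.
  by apply: measurable_funD => //; exact: measurable_cst.
have mtaylor : cmeasurable (fun w => taylor kappa r (0 +i* eps) (fun I => X I t w)).
  apply: cmeasurable_sum => k; apply: cmeasurable_sum => I; exact: cmeasurableZ.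
have C_ge0 : 0 <= C by exact: sqrtr_ge0.
apply: (@L2norm_le _ _ _ _ _ G) => //.
- apply: cmeasurableB => //; exact: mZ.
- by rewrite mulr_ge0// ltW.
- apply: filterS Zae => w [_ ImZ _ ZE].
  have [X0 _ _ _] := iX.
  rewrite taylor_split; last exact: X0.
  pose Q := \sum_(k < r) \sum_(I : k.+1.-tuple 'I_2)
    V_Id kappa I (0 +i* eps) * (X I t w)%:C.
  rewrite -/Q (_ : _ - _ = (Z t w - (0 +i* eps) - (B t w)%:C) + ((B t w)%:C + - Q)); last by ring.
  apply: (le_trans (@le_normcD R _ _)); apply: lerD.
    apply: le_trans (loewner_drift kappa_gt0 eps0 t0 ImZ ZE) _.
    rewrite /a -mulrA ler_wpM2l ?divr_ge0// ?(ltW kappa_gt0)//.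
    by rewrite ler_pdivrMl// -expr2.
  apply: (le_trans (@le_normcD R _ _)); rewrite normc_real lerD2l normcN.
  apply: (le_trans (normc_sum _ _)); apply: ler_sum => k _.
  apply: (le_trans (normc_sum _ _)); apply: ler_sum => I _.
  by rewrite ComplexField.Normc.normcM normc_real.
- apply: (@le_trans _ _ (2%:E * (((a * eps) ^+ 2)%:E +
    2%:E * ((8 * eps ^+ 2)%:E + (S' * eps ^+ 2)%:E)))%E).
    apply: le_trans (msqD_le _ _ mBV) _; first exact: measurable_cst.
    rewrite msq_cst lee_wpmul2l// leeD2l//.
    apply: le_trans (msqD_le _ mB mV) _; rewrite lee_wpmul2l// leeD//.
    by rewrite msq_norm (le_trans Bt2)// lee_fin ler_wpM2l.
  rewrite -!(EFinD, EFinM) lee_fin [leRHS]exprMn /C sqr_sqrtr; last first.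
    by rewrite mulr_ge0// addr_ge0 ?sqr_ge0// mulr_ge0// addr_ge0.
  by rewrite le_eqVlt; apply/orP; left; apply/eqP; ring.
Qed.
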